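(* Let $(R,\mathfrak{m})$ be a finite local ring of characteristic $p^N$ with residue field $\mathbb{F}_q$, $q=p^n$, $n>1$, and let $\rho=\dim_{\mathbb{F}_q}\big(\mathfrak{m}/(\mathfrak{m}^2+pR)\big)$. Every maximal subring $S$ of $R$ is of exactly one of two kinds: (i) $S$ has residue field $\mathbb{F}_q$; there are exactly $\dfrac{q^\rho-1}{q-1}$ such maximal subrings (zero exactly when $R$ is isomorphic to the Galois ring $R(N,n)$), and each has index $q$ in $R$; (ii) $S$ has residue field a maximal proper subfield $\mathbb{F}$ of $\mathbb{F}_q$; for each maximal subfield $\mathbb{F}$ there is exactly one such maximal subring, namely $\pi^{-1}(\mathbb{F})$ where $\pi:R\to R/\mathfrak{m}=\mathbb{F}_q$ is the projection, and its index is $[R:\pi^{-1}(\mathbb{F})]=[\mathbb{F}_q:\mathbb{F}]$ (the order of the quotient group $\mathbb{F}_q/\mathbb{F}$). The number of maximal subrings of the second kind equals the number of distinct prime divisors of $n$.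
   Context: All rings are commutative and unital; subrings share the unit. A subring $S$ of a finite local ring $(R,\mathfrak{m})$ is local with $\mathfrak{m}_S=\mathfrak{m}\cap S$, and its residue field is naturally a subfield of $R/\mathfrak{m}$. Indices are indices of additive groups. The Galois ring $R(N,n)$ is $(\mathbb{Z}/p^N\mathbb{Z})[x]/(f)$ for a monic $f$ of degree $n$ irreducible modulo $p$. *)

(* Defs.v *)
From HB Require Import structures.
From mathcomp Require Import all_boot all_order all_algebra all_field.
Set Implicit Arguments. Unset Strict Implicit. Unset Printing Implicit Defensive.
Import GRing.Theory.
Local Open Scope ring_scope.

Definition is_ideal (R : finComNzRingType) (I : {set R}) : bool :=
  [&& (0 \in I),
      [forall x in I, forall y in I, x + y \in I] &
      [forall r : R, forall x in I, r * x \in I]].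

Definition is_max_ideal (R : finComNzRingType) (I : {set R}) : bool :=
  [&& is_ideal I, (1 \notin I) &
      [forall J : {set R}, (is_ideal J && (1 \notin J) && (I \subset J)) ==> (J == I)]].

Definition ideal_gen (R : finComNzRingType) (G : {set R}) : {set R} :=
  [set x | [forall J : {set R}, (is_ideal J && (G \subset J)) ==> (x \in J)]].

Definition msq_pR (R : finComNzRingType) (m : {set R}) (p : nat) : {set R} :=
  ideal_gen ([set a * b | a in m, b in m] :|: [set p%:R]).

(* Subrings (sharing the unit): literal unfolding of ssralg's subring_closed. *)
Definition is_subring (R : finComNzRingType) (S : {set R}) : bool :=
  (1 \in S) && [forall x in S, forall y in S, (x - y \in S) && (x * y \in S)].

Definition is_max_subring (R : finComNzRingType) (S : {set R}) : bool :=
  [&& is_subring S, (S != setT) &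
      [forall T : {set R}, (is_subring T && (S \subset T)) ==> ((T == S) || (T == setT))]].

(* Subfields of a (finite) field: literal unfolding of divring_closed. *)
Definition is_subfield (K : finFieldType) (F : {set K}) : bool :=
  (1 \in F) && [forall x in F, forall y in F, (x - y \in F) && (x / y \in F)].

Definition is_max_subfield (K : finFieldType) (F : {set K}) : bool :=
  [&& is_subfield F, (F != setT) &
      [forall T : {set K}, (is_subfield T && (F \subset T)) ==> ((T == F) || (T == setT))]].

Definition iso_galois_ring (R : finComNzRingType) (p N n : nat) : Prop :=
  exists f : {poly 'Z_(p ^ N)},
    [/\ f \is monic, size f = n.+1,
        irreducible_poly (map_poly (fun c : 'Z_(p ^ N) => (val c)%:R : 'F_p) f) &
        exists phi : {rmorphism R -> {poly %/ f}}, bijective phi].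

(* Main.v *)
Require Import Defs.
From HB Require Import structures.
From mathcomp Require Import all_boot all_order all_algebra all_field.
From mathcomp Require Import all_fingroup all_solvable ring.
Import GRing.Theory.
Local Open Scope ring_scope.

(* Write J = m^2 + pR.  A subring S with pi(S) = F_q that is maximal contains J,
   and x - x^q lies in m for every x, where x^q is modulo J the Teichmueller part
   of x.  In coordinates m / J = F_q^rho, the map x |-> x - x^q becomes a
   derivation D : R -> F_q^rho, and the maximal subrings of the first kind are
   the kernels of the derivations u o D with u a nonzero linear form; u is
   determined up to a scalar.
   The second kind reduces to the subfields of F_q, the fixed fields of the
   powers of the Frobenius.
   If rho = 0 then m = pR by Nakayama, and a lift a of a generator of the
   multiplicative group of F_q satisfies R = Z[a] with a monic equation of
   degree n. *)

Set Implicit Arguments. Unset Strict Implicit. Unset Printing Implicit Defensive.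

(** The ideal J does two jobs. It contains p, so x |-> x^q is additive modulo J; it contains m^2, so
    R acts on m / J through F_q, and the q-th power kills m modulo J. The additivity of D and the
    Leibniz rule rest on these facts. The form u is found on S and m alone: as pi(S) = F_q, the
    image of their intersection in m / J is a subspace, proper because S is. It then controls all of
    S, since x - x^q lies in that intersection for every x in S. No quotient is formed. The space m
    / J is seen through a coordinate function on R that is meaningful on m only, and dimensions and
    indices are read off from cardinalities. Nakayama takes the form of a statement on adjacent
    ideals, whose quotient is killed by m; it serves both for J being contained in S and for m = pR.
    Conversely, a Galois ring has m = pR because a Bezout identity modulo p lifts to an identity up
    to multiples of p. *)

Section IdealsAndSubrings.

Variable R : finComNzRingType.
Implicit Types (I C D G S : {set R}) (x y r : R).

Lemma is_idealP I :
  reflect [/\ 0 \in I, {in I &, forall x y, x + y \in I}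
            & forall r, {in I, forall x, r * x \in I}] (is_ideal I).
Proof.
apply: (iffP and3P) => -[I0 ID IM]; split=> //.
- by move=> x y xI yI; apply: (forall_inP (forall_inP ID x xI)).
- by move=> r x xI; apply: (forall_inP (forallP IM r)).
- by apply/forall_inP=> x xI; apply/forall_inP=> y yI; apply: ID.
- by apply/forallP=> r; apply/forall_inP=> x xI; apply: IM.
Qed.

Lemma mem_ideal0 I : is_ideal I -> 0 \in I.
Proof. by case/is_idealP. Qed.

Lemma mem_idealD I x y : is_ideal I -> x \in I -> y \in I -> x + y \in I.
Proof. by case/is_idealP=> _ ID _; apply: ID. Qed.

Lemma mem_idealMl I r x : is_ideal I -> x \in I -> r * x \in I.
Proof. by case/is_idealP=> _ _; apply. Qed.

Lemma mem_idealMr I r x : is_ideal I -> x \in I -> x * r \in I.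
Proof. by rewrite mulrC; apply: mem_idealMl. Qed.

Lemma mem_idealN I x : is_ideal I -> x \in I -> - x \in I.
Proof. by rewrite -mulN1r; apply: mem_idealMl. Qed.

Lemma mem_idealB I x y : is_ideal I -> x \in I -> y \in I -> x - y \in I.
Proof. by move=> iI xI yI; apply: mem_idealD => //; apply: mem_idealN. Qed.

Lemma mem_idealBr I x y : is_ideal I -> x - y \in I -> y \in I -> x \in I.
Proof. by move=> iI xyI yI; rewrite -(subrK y x); apply: mem_idealD. Qed.

Lemma ideal_sum I (T : finType) (F : T -> R) :
  is_ideal I -> (forall i, F i \in I) -> \sum_i F i \in I.
Proof.
move=> iI FI; apply: (big_ind (fun x => x \in I)) => //; first exact: mem_ideal0.
by move=> x y; apply: mem_idealD.
Qed.

Lemma is_ideal_setT : is_ideal [set: R].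
Proof. by apply/is_idealP; split=> [|x y _ _|r x _]; rewrite inE. Qed.

Lemma ideal_gen_ideal G : is_ideal (ideal_gen G).
Proof.
apply/is_idealP; split=> [|x y|r x]; rewrite !inE.
- by apply/forall_inP=> J /andP[iJ _]; apply: mem_ideal0.
- move=> /forall_inP xI /forall_inP yI; apply/forall_inP=> J HJ.
  by apply: mem_idealD; rewrite ?xI ?yI //; case/andP: HJ.
- move=> /forall_inP xI; apply/forall_inP=> J HJ.
  by apply: mem_idealMl; rewrite ?xI //; case/andP: HJ.
Qed.

Lemma sub_ideal_gen G : G \subset ideal_gen G.
Proof.
apply/subsetP=> x xG; rewrite inE; apply/forall_inP=> J /andP[_ /subsetP].
exact.
Qed.

Lemma ideal_gen_min G I : is_ideal I -> G \subset I -> ideal_gen G \subset I.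
Proof.
move=> iI sGI; apply/subsetP=> x; rewrite inE => /forall_inP; apply.
by rewrite iI.
Qed.

(** The ideal C + Ry. *)
Definition ideal_adj C y : {set R} := [set x | [exists r, x - r * y \in C]].

Lemma ideal_adjP C y x :
  reflect (exists r, x - r * y \in C) (x \in ideal_adj C y).
Proof. by rewrite inE; apply: existsP. Qed.

Lemma ideal_adj_ideal C y : is_ideal C -> is_ideal (ideal_adj C y).
Proof.
move=> iC; apply/is_idealP; split.
- by apply/ideal_adjP; exists 0; rewrite mul0r subr0 mem_ideal0.
- move=> u v /ideal_adjP[r Hr] /ideal_adjP[s Hs]; apply/ideal_adjP.
  by exists (r + s); rewrite mulrDl opprD addrACA mem_idealD.
- move=> s u /ideal_adjP[r Hr]; apply/ideal_adjP.
  by exists (s * r); rewrite -mulrA -mulrBr mem_idealMl.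
Qed.

Lemma sub_ideal_adj C y : is_ideal C -> C \subset ideal_adj C y.
Proof.
move=> iC; apply/subsetP=> x xC; apply/ideal_adjP; exists 0.
by rewrite mul0r subr0.
Qed.

Lemma mem_ideal_adj C y : is_ideal C -> y \in ideal_adj C y.
Proof. by move=> iC; apply/ideal_adjP; exists 1; rewrite mul1r subrr mem_ideal0. Qed.

Lemma ideal_adj_min C D y :
  is_ideal D -> C \subset D -> y \in D -> ideal_adj C y \subset D.
Proof.
move=> iD /subsetP sCD yD; apply/subsetP=> x /ideal_adjP[r /sCD Hr].
by apply: mem_idealBr Hr _ => //; apply: mem_idealMl.
Qed.

Lemma is_subringP S :
  reflect [/\ 1 \in S, {in S &, forall x y, x - y \in S}
            & {in S &, forall x y, x * y \in S}] (is_subring S).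
Proof.
apply: (iffP andP) => [[S1 /forall_inP SBM]|[S1 SB SM]].
  by split=> // x y xS yS; have /forall_inP/(_ y yS)/andP[] := SBM x xS.
split=> //; apply/forall_inP=> x xS; apply/forall_inP=> y yS.
by rewrite SB ?SM.
Qed.

Lemma subring1 S : is_subring S -> 1 \in S.
Proof. by case/is_subringP. Qed.

Lemma subringB S x y : is_subring S -> x \in S -> y \in S -> x - y \in S.
Proof. by case/is_subringP=> _ SB _; apply: SB. Qed.

Lemma subringM S x y : is_subring S -> x \in S -> y \in S -> x * y \in S.
Proof. by case/is_subringP=> _ _ SM; apply: SM. Qed.

Lemma subring0 S : is_subring S -> 0 \in S.
Proof. by move=> sS; rewrite -(subrr 1) subringB ?subring1. Qed.

Lemma subringD S x y : is_subring S -> x \in S -> y \in S -> x + y \in S.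
Proof.
by move=> sS xS yS; rewrite -(opprK y) -[- y]add0r !subringB ?subring0.
Qed.

Lemma subringX S x k : is_subring S -> x \in S -> x ^+ k \in S.
Proof.
move=> sS xS; elim: k => [|k IHk]; first by rewrite expr0 subring1.
by rewrite exprS subringM.
Qed.

Lemma subring_nat S k : is_subring S -> k%:R \in S.
Proof.
move=> sS; elim: k => [|k IHk]; first exact: subring0.
by rewrite -natr1 subringD ?subring1.
Qed.

Lemma is_max_subringP S :
  reflect [/\ is_subring S, S != setT & forall T, is_subring T -> S \subset T ->
             T = S \/ T = setT] (is_max_subring S).
Proof.
apply: (iffP and3P) => -[sS nS maxS]; split=> //.
  move=> T sT sST; have /forallP/(_ T) := maxS; rewrite sT sST /=.
  by case/orP=> /eqP; [left | right].
apply/forallP=> T; apply/implyP=> /andP[sT sST].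
by case: (maxS T sT sST) => ->; rewrite eqxx ?orbT.
Qed.

End IdealsAndSubrings.

(** Every nonempty fibre is a translate of the kernel. Additivity is asked on [A] only, since the
    coordinates of m / J are additive on m and arbitrary elsewhere. *)
Lemma card_additive_on (G H : finZmodType) (A : {set G}) (f : G -> H) :
  {in A &, forall x y, x - y \in A} ->
  {in A &, forall x y, f (x - y) = f x - f y} ->
  #|A| = (#|f @: A| * #|[set x in A | f x == 0%R]|)%N.
Proof.
move=> AB fB; rewrite -sum1_card (partition_big_imset f) /=.
rewrite -sum_nat_const; apply: eq_bigr => _ /imsetP[a aA ->].
rewrite sum1dep_card -(card_imset _ (addIr (- a))); apply: eq_card => x.
apply/imsetP/idP => [[y]|].
  by rewrite inE => /andP[yA /eqP fy] ->; rewrite inE AB //= fB // fy subrr.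
rewrite inE => /andP[xA /eqP fx].
have A0 : 0 \in A by rewrite -(subrr a) AB.
have NA : - a \in A by rewrite -[- a]add0r AB.
exists (x + a); last by rewrite addrK.
have f0 : f 0 = 0 by rewrite -(subrr a) fB // subrr.
have fN : f (- a) = - f a by rewrite -(sub0r a) fB // f0 !sub0r.
by rewrite inE -{1 2}(opprK a) AB //= fB // fx fN sub0r opprK.
Qed.

Lemma card_preim_additive (G H : finZmodType) (f : {additive G -> H})
    (B : {set H}) : {in B &, forall x y, x - y \in B} ->
  (forall y, exists x, f x = y) ->
  #|f @^-1: B| = (#|B| * #|[set x | f x == 0%R]|)%N.
Proof.
move=> BB fsurj; have [->|[b bB]] := set_0Vmem B.
  by rewrite preimset0 !cards0.
have B0 : 0 \in B by rewrite -(subrr b) BB.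
rewrite (@card_additive_on _ _ _ f).
- congr (_ * _)%N.
    apply: eq_card => y; apply/imsetP/idP => [[x]|yB].
      by rewrite inE => fxB ->.
    by have [x fx] := fsurj y; exists x; rewrite // inE fx.
  apply: eq_card => x; rewrite !inE; case: eqP => [->|]; last by rewrite andbF.
  by rewrite B0.
- by move=> x y; rewrite !inE raddfB; apply: BB.
- by move=> x y _ _; rewrite raddfB.
Qed.

(* Both ideals being adjacent, [D / C] is a simple module, hence killed by [m]. *)
Lemma adjacent_ideals_mul (R : finComNzRingType) (m C D : {set R}) :
  is_ideal m -> (forall y, y \in m -> exists z, (1 - y) * z = 1) ->
  is_ideal C -> is_ideal D -> C \subset D ->
  (forall I, is_ideal I -> C \subset I -> I \subset D -> I = C \/ I = D) ->
  forall x y, x \in m -> y \in D -> x * y \in C.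
Proof.
move=> im munit iC iD sCD adj x y xm yD.
have [|exyC|exyD] := adj _ (ideal_adj_ideal (x * y) iC) (sub_ideal_adj _ iC).
- by apply: ideal_adj_min => //; apply: mem_idealMl.
- by rewrite -exyC mem_ideal_adj.
(* Now y = rxy modulo [C], so (1 - rx)y lies in [C], and 1 - rx is invertible because rx is in
   [m]. *)
have : y \in ideal_adj C (x * y) by rewrite exyD.
case/ideal_adjP=> r Hr.
have [z Hz] := munit _ (mem_idealMl r im xm).
have -> : x * y = x * z * (y - r * (x * y)).
  by rewrite !mulrA -{2}(mul1r y) -mulrBl !mulrA -(mulrA x z) (mulrC z) Hz mulr1.
exact: mem_idealMl.
Qed.

(** In a finite field the inverse of y is the power y^(|K| - 2), so closure under products already
    gives closure under division. *)
Lemma is_subfieldE (K : finFieldType) (F : {set K}) :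
  is_subfield F = is_subring F.
Proof.
apply/andP/is_subringP => [[F1 /forall_inP FBV]|[F1 FB FM]].
  have {}FBV x y : x \in F -> y \in F -> (x - y \in F) && (x / y \in F).
    by move=> xF yF; apply: (forall_inP (FBV x xF)).
  split=> // x y xF yF; first by case/andP: (FBV x y xF yF).
  have /andP[_] := FBV 1 y F1 yF; rewrite mul1r => VyF.
  by have /andP[_] := FBV x _ xF VyF; rewrite invrK.
split=> //; apply/forall_inP=> x xF; apply/forall_inP=> y yF.
rewrite FB ?FM //=; have [->|ny] := eqVneq y 0.
  by rewrite invr0 -(subrr 1) FB.
suff -> : y^-1 = y ^+ (#|K| - 2).
  by elim: (_ - 2)%N => [|k IHk]; rewrite ?expr0 // exprS FM.
apply: (mulfI ny); apply: (mulfI ny); rewrite mulfV // mulr1 -!exprS.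
by rewrite -addn2 subnK ?expf_card //; apply: finNzRing_gt1.
Qed.

Lemma is_max_subfieldE (K : finFieldType) (F : {set K}) :
  is_max_subfield F = is_max_subring F.
Proof.
rewrite /is_max_subfield /is_max_subring is_subfieldE; congr [&& _, _ & _].
by apply: eq_forallb => T; rewrite is_subfieldE.
Qed.

(** * Subrings and their images in the residue field *)

Section Residue.

Variables (R : finComNzRingType) (K : finFieldType) (pi : {rmorphism R -> K}).
Hypothesis pi_surj : forall y, exists x, pi x = y.
Implicit Types (S : {set R}) (F : {set K}).

Lemma im_preim_surj F : pi @: (pi @^-1: F) = F.
Proof.
apply/setP=> y; apply/imsetP/idP => [[x]|yF]; first by rewrite inE => ? ->.
by have [x xy] := pi_surj y; exists x; rewrite ?inE xy.
Qed.

Lemma preim_subring F : is_subring F -> is_subring (pi @^-1: F).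
Proof.
move=> sF; apply/is_subringP; split=> [|x y|x y]; rewrite !inE.
- by rewrite rmorph1 subring1.
- by rewrite rmorphB; apply: subringB.
- by rewrite rmorphM; apply: subringM.
Qed.

Lemma im_subring S : is_subring S -> is_subring (pi @: S).
Proof.
move=> sS; apply/is_subringP; split.
- by rewrite -(rmorph1 pi) imset_f ?subring1.
- move=> _ _ /imsetP[x xS ->] /imsetP[y yS ->].
  by rewrite -rmorphB imset_f ?subringB.
- move=> _ _ /imsetP[x xS ->] /imsetP[y yS ->].
  by rewrite -rmorphM imset_f ?subringM.
Qed.

Lemma preim_im_subring S : is_subring S -> (forall x, pi x = 0 -> x \in S) ->
  pi @^-1: (pi @: S) = S.
Proof.
move=> sS kS; apply/setP=> x; rewrite inE; apply/imsetP/idP => [[y yS xy]|xS].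
  by rewrite -(subrK y x) subringD // kS // rmorphB xy subrr.
by exists x.
Qed.

(** The preimage of pi(S) is a subring above [S], proper because pi(S) is; maximality makes it
    [S]. *)
Lemma max_subring_im S : is_max_subring S -> pi @: S != setT ->
  S = pi @^-1: (pi @: S) /\ is_max_subfield (pi @: S).
Proof.
case/is_max_subringP=> sS nS maxS nT.
have eS : S = pi @^-1: (pi @: S).
  have [||//|eT] := maxS (pi @^-1: (pi @: S)).
  - exact/preim_subring/im_subring.
  - by apply/subsetP=> x xS; rewrite inE imset_f.
  by rewrite -(im_preim_surj (pi @: S)) eT -(preimsetT pi) im_preim_surj eqxx in nT.
split=> //; rewrite is_max_subfieldE; apply/is_max_subringP; split=> //.
  exact: im_subring.
move=> T sT sST; have [||eT|eT] := maxS (pi @^-1: T).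
- exact: preim_subring.
- by rewrite {1}eS; apply: preimsetS.
- by left; rewrite -eT im_preim_surj.
- by right; rewrite -(im_preim_surj T) eT -(preimsetT pi) im_preim_surj.
Qed.

Lemma max_subfield_preim F : is_max_subfield F -> is_max_subring (pi @^-1: F).
Proof.
rewrite is_max_subfieldE => /is_max_subringP[sF nF maxF].
apply/is_max_subringP; split; first exact: preim_subring.
  apply: contraNneq nF => eT.
  by rewrite -(im_preim_surj F) eT -(preimsetT pi) im_preim_surj.
move=> T sT sFT.
(* A subring above the preimage of [F] contains the kernel of [pi], so it is determined by its
   image. *)
have eT : pi @^-1: (pi @: T) = T.
  apply: preim_im_subring => // x x0.
  by apply: (subsetP sFT); rewrite inE x0 subring0.
have [||<-|eK] := maxF (pi @: T); first exact: im_subring.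
- by rewrite -(im_preim_surj F); apply: imsetS.
- by left.
- by right; rewrite -eT eK preimsetT.
Qed.

Lemma max_subring_im_preim S F :
  is_max_subfield F -> is_max_subring S -> pi @: S = F -> S = pi @^-1: F.
Proof.
move=> mF mS eF; have [] := max_subring_im mS; last by rewrite eF.
by rewrite eF; case/and3P: mF.
Qed.

Lemma card_max_subrings_im_subfield :
  #|[set S : {set R} | is_max_subring S && is_max_subfield (pi @: S)]|
    = #|[set F : {set K} | is_max_subfield F]|.
Proof.
have inj : injective (fun F : {set K} => pi @^-1: F).
  by move=> F F' eF; rewrite -(im_preim_surj F) eF im_preim_surj.
rewrite -(card_imset _ inj); apply: eq_card => S; rewrite inE.
apply/andP/imsetP => [[mS mF]|[F]].
  by exists (pi @: S); rewrite ?inE //; apply: max_subring_im_preim.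
by rewrite inE => mF ->; rewrite im_preim_surj max_subfield_preim.
Qed.

End Residue.

(** * Subfields of a finite field *)

Section Subfields.

Variables (K : finFieldType) (p n : nat).
Hypotheses (p_pr : prime p) (cardK : #|K| = (p ^ n)%N).

Let card_pchar : p \in [pchar K]. Proof. exact: card_finPcharP cardK p_pr. Qed.

(** For d = 0 this is all of [K], whence the positivity conditions on d below. *)
Definition fix_Frobenius d : {set K} := [set x | x ^+ (p ^ d) == x].
Local Notation Fix := fix_Frobenius.

Lemma Fix_subring d : is_subring (Fix d).
Proof.
have pd : [pchar K].-nat (p ^ d)%N.
  by rewrite pnatX pnatE // card_pchar.
apply/is_subringP; split=> [|x y|x y]; rewrite !inE ?expr1n //.
  by move=> /eqP xd /eqP yd; rewrite exprDn_pchar // exprNn_pchar // xd yd.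
by move=> /eqP xd /eqP yd; rewrite exprMn xd yd.
Qed.

Lemma card_Fix_le d : (0 < d)%N -> (#|Fix d| <= p ^ d)%N.
Proof.
move=> d0; have pd1 : (1 < p ^ d)%N by rewrite -(exp1n d) ltn_exp2r ?prime_gt1.
have sz : size ('X^(p ^ d) - 'X : {poly K}) = (p ^ d).+1.
  by rewrite size_polyDl size_polyXn // size_polyN size_polyX.
rewrite -ltnS -sz cardE; apply: max_poly_roots.
- by rewrite -size_poly_gt0 sz.
- apply/allP=> x; rewrite mem_enum inE => /eqP xd.
  by rewrite /root !hornerE xd subrr.
- exact: enum_uniq.
Qed.

Lemma expf_Fix d k (x : K) : x ^+ (p ^ d) = x -> x ^+ (p ^ (d * k)) = x.
Proof.
move=> xd; elim: k => [|k IHk]; first by rewrite muln0.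
by rewrite mulnS expnD exprM xd.
Qed.

Lemma Fix_sub d e : (d %| e)%N -> Fix d \subset Fix e.
Proof.
case/dvdnP=> k ->; apply/subsetP=> x; rewrite !inE => /eqP xd.
by rewrite mulnC expf_Fix.
Qed.

(** Bezout gives ud = ve + gcd(d, e). The Frobenius iterated ud times and ve times fixes x, so it
    does so when iterated gcd(d, e) times. *)
Lemma Fix_gcd d e x : (0 < d)%N -> x \in Fix d -> x \in Fix e ->
  x \in Fix (gcdn d e).
Proof.
rewrite !inE => d0 /eqP xd /eqP xe.
case: (@egcdnP d e d0) => u v eq_uv _.
by rewrite -{2}(expf_Fix u xd) mulnC eq_uv expnD exprM mulnC expf_Fix.
Qed.

(** The lower bound comes from the cyclic unit group: p^d - 1 divides p^n - 1, so some h has order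
    p^d - 1, and its powers together with 0 are fixed. *)
Lemma card_Fix d : (0 < d)%N -> (d %| n)%N -> #|Fix d| = (p ^ d)%N.
Proof.
move=> d0 dn; apply/eqP; rewrite eqn_leq card_Fix_le //=.
have /cyclicP[g gE] := field_unit_group_cyclic [set: {unit K}]%G.
have og : #[g]%g = (p ^ n).-1 by rewrite /order -gE card_finField_unit cardK.
have pd0 k : (0 < p ^ k)%N by rewrite expn_gt0 prime_gt0.
have pd1 : (1 < p ^ d)%N by rewrite -(exp1n d) ltn_exp2r ?prime_gt1.
have dvd : ((p ^ d).-1 %| #[g]%g)%N.
  by rewrite og; case/dvdnP: dn => k ->; rewrite mulnC expnM dvdn_pred_predX.
set h := (g ^+ (#[g]%g %/ (p ^ d).-1))%g.
have oh : #[h]%g = (p ^ d).-1.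
  rewrite orderXdiv; last exact: dvdn_div.
  by rewrite divnA // mulKn // order_gt0.
have sub : 0 |: [set FinRing.uval u | u in <[h]>%g] \subset Fix d.
  apply/subsetP=> x; rewrite in_setU1 inE => /orP[/eqP->|/imsetP[u uh ->]].
    by rewrite expr0n eqn0Ngt pd0.
  rewrite -(prednK (pd0 d)) exprS -oh -FinRing.val_unitX.
  by rewrite (expg_cardG uh) mulr1.
apply: leq_trans (subset_leq_card sub).
rewrite cardsU1 card_imset; last exact: val_inj.
rewrite -/(order h) oh; case: imsetP => [[u _ u0]|_ /=].
  by have := valP u; rewrite /= -u0 unitr0.
by rewrite add1n prednK.
Qed.

(** Fermat's argument inside [F]: multiplication by x permutes the nonzero elements, and comparing
    their products gives x^(|F| - 1) = 1. *)
Lemma expf_card_subring (F : {set K}) x :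
  is_subring F -> x \in F -> x ^+ #|F| = x.
Proof.
move=> sF xF; have [->|nx] := eqVneq x 0.
  by rewrite expr0n; case: eqP => // /eqP; rewrite cards_eq0 => /eqP F0;
     have := subring0 sF; rewrite F0 inE.
have F0 := subring0 sF.
have sF' := sF; rewrite -is_subfieldE in sF'.
have VF y : y \in F -> x^-1 * y \in F.
  case/andP: sF' => _ /forall_inP FF yF.
  by have /forall_inP/(_ x xF)/andP[_] := FF y yF; rewrite mulrC.
have : \prod_(y in F :\ 0) y = \prod_(y in F :\ 0) (x * y).
  rewrite [LHS](reindex_inj (mulfI nx)); apply: eq_bigl => y.
  rewrite !inE mulf_eq0 (negPf nx) /=; congr (_ && _).
  apply/idP/idP=> [/VF|]; first by rewrite mulKf.
  exact: subringM.
rewrite big_split /= prodr_const => /esym/eqP.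
rewrite -subr_eq0 -{2}[\prod_(y in _) y]mul1r -mulrBl mulf_eq0 => /orP[].
  by rewrite subr_eq0 => /eqP x1; rewrite (cardsD1 0 F) F0 exprS x1 mulr1.
by rewrite prodf_seq_eq0 => /hasP[y _]; rewrite !inE; case: eqP => //=; rewrite andbF.
Qed.

Lemma subring_Fix (F : {set K}) : is_subring F ->
  exists d, [/\ (0 < d)%N, (d %| n)%N & F = Fix d].
Proof.
move=> sF.
have gF : group_set F.
  apply/group_setP; split=> [|x y]; first exact: subring0.
  exact: subringD.
have := cardSg (subsetT (Group gF)); rewrite cardsT cardK /= => /(dvdn_pfactor _ _ p_pr)[d _ cF].
have sFd : F \subset Fix d.
  by apply/subsetP=> x xF; rewrite inE -cF expf_card_subring.
have d0 : (0 < d)%N.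
  rewrite lt0n; apply: contraTneq (oner_neq0 K) => d0.
  have : (#|[set (0%R : K); 1%R]| <= #|F|)%N.
    by apply: subset_leq_card; apply/subsetP=> x /set2P[] ->; rewrite ?subring0 ?subring1.
  by rewrite cF d0 cards2 eq_sym; case: eqP.
exists d; split=> //; last by apply/eqP; rewrite eqEcard sFd cF card_Fix_le.
(* All of [K] is fixed by n iterations, so p^d <= p^gcd(d, n); this forces d to divide n. *)
have sFg : F \subset Fix (gcdn d n).
  apply/subsetP=> x xF; apply: Fix_gcd => //; first exact: (subsetP sFd).
  by rewrite inE -cardK expf_card.
have := leq_trans (subset_leq_card sFg) (card_Fix_le _).
rewrite gcdn_gt0 d0 cF leq_exp2l ?prime_gt1 // => /(_ isT) dg.
by apply/gcdn_idPl/eqP; rewrite eqn_leq dg dvdn_leq ?dvdn_gcdl.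
Qed.

Lemma Fix_subE d e : (0 < d)%N -> (0 < e)%N -> (d %| n)%N ->
  (Fix d \subset Fix e) = (d %| e)%N.
Proof.
move=> d0 e0 dn; apply/idP/idP=> [/subsetP sde|]; last exact: Fix_sub.
have sdg : Fix d \subset Fix (gcdn d e).
  by apply/subsetP=> x xd; apply: Fix_gcd => //; apply: sde.
have := leq_trans (subset_leq_card sdg) (card_Fix_le _).
rewrite gcdn_gt0 d0 card_Fix // leq_exp2l ?prime_gt1 // => /(_ isT) dg.
by apply/gcdn_idPl/eqP; rewrite eqn_leq dg dvdn_leq ?dvdn_gcdl.
Qed.

(** Subfields correspond to divisors of n, ordered by divisibility, so the maximal ones belong to n
    / l for the primes l dividing n. *)
Lemma card_max_subfields : (1 < n)%N ->
  #|[set F : {set K} | is_max_subfield F]| = size (primes n).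
Proof.
move=> n1; have n0 := ltnW n1.
have FixT : Fix n = setT by apply/setP=> x; rewrite !inE -cardK expf_card eqxx.
pose f l := Fix (n %/ l).
have divP l : l \in primes n -> [/\ prime l, (0 < n %/ l)%N, (n %/ l %| n)%N & n = (n %/ l * l)%N].
  rewrite mem_primes => /and3P[pl _ ln]; split=> //.
  - by rewrite divn_gt0 ?prime_gt0 // dvdn_leq.
  - by apply: dvdn_div.
  - by rewrite divnK.
suff -> : [set F : {set K} | is_max_subfield F] = [set F in map f (primes n)].
  rewrite cardsE (card_uniqP _) ?size_map // map_inj_in_uniq ?primes_uniq //.
  move=> l l' /divP[pl l0 ln nl] /divP[pl' l0' ln' nl'] ff.
  have : (n %/ l)%N = (n %/ l')%N.
    have {}ff : Fix (n %/ l) = Fix (n %/ l') := ff.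
    apply/eqP; rewrite eqn_dvd -(Fix_subE l0 l0' ln) -(Fix_subE l0' l0 ln').
    by rewrite ff subxx.
  move=> e; apply/eqP; rewrite -(eqn_pmul2l l0) -nl e -nl' //.
apply/setP=> F; rewrite !inE is_max_subfieldE.
apply/is_max_subringP/mapP => [[sF nF maxF]|[l /divP[pl l0 ln nl] ->]].
  have [d [d0 dn eF]] := subring_Fix sF.
  have nd : (1 < n %/ d)%N.
    rewrite ltn_divRL // mul1n ltn_neqAle dvdn_leq // andbT.
    by apply: contraNneq nF => dn'; rewrite eF dn' FixT.
  (* Any prime l dividing n / d works: d divides n / l, so [F] lies in the proper subfield attached
     to n / l and equals it by maximality. *)
  have lpr := pdiv_prime nd; set l := pdiv _ in lpr.
  have lnd : (l %| n %/ d)%N := pdiv_dvd _.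
  have ln : (l %| n)%N := dvdn_trans lnd (dvdn_div dn).
  have lP : l \in primes n by rewrite mem_primes lpr n0.
  exists l => //; have [_ nl0 nln nE] := divP _ lP.
  have [||//|] := maxF (f l); first exact: Fix_subring.
    rewrite eF; apply: Fix_sub; rewrite dvdn_divRL // mulnC.
    by rewrite -dvdn_divRL.
  move=> fT; have := card_Fix nl0 nln; rewrite -/(f l) fT cardsT cardK.
  move/eqP; rewrite eqn_exp2l ?prime_gt1 // eq_sym => /eqP enl.
  have := ltn_Pdiv (prime_gt1 lpr) n0; by rewrite enl ltnn.
have nlt : (n %/ l < n)%N by rewrite ltn_Pdiv ?prime_gt1.
split; first exact: Fix_subring.
  apply/eqP=> fT; have := card_Fix l0 ln; rewrite -/(f l) fT cardsT cardK.
  by move/eqP; rewrite eqn_exp2l ?prime_gt1 // => /eqP e; rewrite -e ltnn in nlt.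
move=> T sT; have [e [e0 en ->]] := subring_Fix sT.
rewrite Fix_subE // => /dvdnP[k ek].
have kl : (k %| l)%N by rewrite -(dvdn_pmul2r l0) -ek mulnC -nl.
have /primeP[_ /(_ k kl)/orP[]/eqP ke] := pl.
  by left; rewrite ek ke mul1n.
by right; rewrite ek ke mulnC -nl FixT.
Qed.

End Subfields.

(** * Powers of sums modulo p, and linear forms vanishing on a subspace *)

Lemma exprD_prime_mod (R : comNzRingType) (p : nat) (x y : R) : prime p ->
  exists t, (x + y) ^+ p = x ^+ p + y ^+ p + p%:R * t.
Proof.
move=> p_pr; case: p p_pr => // p p_pr.
rewrite exprDn big_ord_recl big_ord_recr /= subn0 subnn !expr0 mulr1 mul1r.
rewrite bin0 binn !mulr1n.
suff [t ->] : exists t, \sum_(i < p) (x ^+ (p.+1 - bump 0 i) * y ^+ bump 0 i)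
    *+ 'C(p.+1, bump 0 i) = p.+1%:R * t.
  by exists t; rewrite addrA addrAC.
apply: (big_ind (fun z => exists t, z = p.+1%:R * t)).
- by exists 0; rewrite mulr0.
- by move=> _ _ [t ->] [t' ->]; exists (t + t'); rewrite mulrDr.
move=> i _; have /dvdnP[k ->] := @prime_dvd_bin (bump 0 i) _ p_pr (ltn_ord i).
exists (x ^+ (p.+1 - bump 0 i) * y ^+ bump 0 i * k%:R).
by rewrite -[LHS]mulr_natr natrM; ring.
Qed.

(** In characteristic p^N additivity holds only up to multiples of p; raising such an error to the
    p-th power leaves a multiple of p. *)
Lemma exprD_prime_power_mod (R : comNzRingType) (p k : nat) (x y : R) :
  prime p -> exists t, (x + y) ^+ (p ^ k) = x ^+ (p ^ k) + y ^+ (p ^ k) + p%:R * t.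
Proof.
move=> p_pr; elim: k => [|k [t IHk]].
  by exists 0; rewrite !expr1 mulr0 addr0.
rewrite expnSr !exprM IHk.
have [t1 ->] := exprD_prime_mod (x ^+ (p ^ k) + y ^+ (p ^ k)) (p%:R * t) p_pr.
have [t2 ->] := exprD_prime_mod (x ^+ (p ^ k)) (y ^+ (p ^ k)) p_pr.
exists (t2 + (p%:R * t) ^+ p.-1 * t + t1).
have -> : (p%:R * t) ^+ p = p%:R * t * (p%:R * t) ^+ p.-1.
  by rewrite -exprS prednK ?prime_gt0.
by ring.
Qed.

(** [W] is the row space of a matrix [A] that is not of full rank; a nonzero column of its cokernel
    matrix is the required form. *)
Lemma proper_subspace_hyperplane (K : finFieldType) k (W : {set 'rV[K]_k}) :
  0 \in W -> {in W &, forall v w, v + w \in W} ->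
  (forall a, {in W, forall v, a *: v \in W}) -> W != setT ->
  exists2 u : 'cV[K]_k, u != 0 & {in W, forall w, w *m u = 0}.
Proof.
move=> W0 WD WZ nW; pose A := (\sum_(w in W) <<w>>)%MS.
have WA w : w \in W -> (w <= A)%MS.
  by move=> wW; apply: (sumsmx_sup w) => //; rewrite genmxE.
have AW v : (v <= A)%MS -> v \in W.
  case/sub_sumsmxP=> c ->; apply: (big_ind (fun v => v \in W)) => // w wW.
  have /sub_rVP[a ->] : (c w *m <<w>> <= w)%MS.
    by rewrite -(genmxE w) submxMl.
  exact: WZ.
have nC : cokermx A != 0.
  rewrite cokermx_eq0; apply: contra nW => fA; apply/eqP/setP=> v.
  by rewrite inE AW // submx_full.
have [j nj] : exists j, col j (cokermx A) != 0.
  apply/existsP; apply: contraNT nC; rewrite negb_exists => /forallP C0.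
  apply/eqP/matrixP=> i j; have /negPn/eqP/colP/(_ i) := C0 j.
  by rewrite !mxE.
exists (col j (cokermx A)) => // w /WA; rewrite submxE => /eqP wA.
by rewrite colE mulmxA wA mul0mx.
Qed.

(** * Local rings, and the inclusion of J in maximal subrings of the first kind *)

Section LocalRing.

Variables (R : finComNzRingType) (m : {set R}).
Hypotheses (Hm : is_max_ideal m) (Hloc : forall J : {set R}, is_max_ideal J -> J = m).

Implicit Types (x y z r : R) (I S : {set R}).

Lemma max_ideal_ideal : is_ideal m.
Proof. by case/and3P: Hm. Qed.
Local Notation mI := max_ideal_ideal.

Lemma max_ideal1 : 1 \notin m.
Proof. by case/and3P: Hm. Qed.

(** If 1 is not in Rx, finiteness gives a maximal ideal above Rx; it is [m] by locality, so x is in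
    [m]. *)
Lemma local_unit x : x \notin m -> exists z, x * z = 1.
Proof.
move=> xm; have i0 : is_ideal [set (0 : R)].
  by apply/is_idealP; split=> [|y z|y z]; rewrite !inE // => /eqP->;
     [rewrite add0r | rewrite mulr0].
have [|n1] := boolP (1 \in ideal_adj [set 0] x).
  case/ideal_adjP=> r; rewrite inE subr_eq0 => /eqP r1.
  by exists r; rewrite mulrC -r1.
have PI : is_ideal (ideal_adj [set 0] x) && (1 \notin ideal_adj [set 0] x).
  by rewrite ideal_adj_ideal.
have [M /maxsetP[/andP[iM M1] maxM] sIM] :=
  @maxset_exists _ (fun I : {set R} => is_ideal I && (1 \notin I)) _ PI.
have eM : M = m.
  apply: Hloc; apply/and3P; split=> //; apply/forallP=> I.
  by apply/implyP=> /andP[iI sMI]; rewrite (maxM I).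
by rewrite -eM (subsetP sIM) ?mem_ideal_adj in xm.
Qed.

Lemma one_sub_unit y : y \in m -> exists z, (1 - y) * z = 1.
Proof.
move=> ym; apply: local_unit; apply: contra max_ideal1 => y1.
by apply: mem_idealBr y1 _ => //; exact: mI.
Qed.

Variables (p : nat).
Hypothesis p_pr : prime p.
Variables (K : finFieldType) (pi : {rmorphism R -> K}).
Hypothesis pi_ker : forall x : R, (pi x == 0) = (x \in m).

Variable n : nat.
Hypothesis cardK : #|K| = (p ^ n)%N.

Local Notation J := (msq_pR m p).

Lemma natr_p_in_m : p%:R \in m.
Proof.
by rewrite -pi_ker rmorph_nat; have /andP[] := card_finPcharP cardK p_pr.
Qed.

Lemma msq_pR_ideal : is_ideal J. Proof. exact: ideal_gen_ideal. Qed.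

Lemma msq_pR_mul x y : x \in m -> y \in m -> x * y \in J.
Proof.
move=> xm ym; apply: (subsetP (sub_ideal_gen _)).
by rewrite inE (imset2_f _ xm ym).
Qed.

Lemma msq_pR_p : p%:R \in J.
Proof. by apply: (subsetP (sub_ideal_gen _)); rewrite !inE eqxx orbT. Qed.

Lemma msq_pR_min I : is_ideal I ->
  (forall x y, x \in m -> y \in m -> x * y \in I) -> p%:R \in I -> J \subset I.
Proof.
move=> iI mmI pI; apply: ideal_gen_min => //; apply/subsetP=> z.
case/setUP=> [/imset2P[x y xm ym ->]|/set1P->//]; exact: mmI.
Qed.

Lemma msq_pR_sub : J \subset m.
Proof.
apply: msq_pR_min natr_p_in_m; first exact: mI.
by move=> x y _; apply: mem_idealMl mI.
Qed.

Lemma eq_mod_m x y : pi x = pi y -> x - y \in m.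
Proof. by move=> xy; rewrite -pi_ker rmorphB xy subrr. Qed.

Lemma m_sub_full (S : {set R}) :
  is_subring S -> pi @: S = setT -> m \subset S -> S = setT.
Proof.
move=> sS piS /subsetP mS; apply/setP=> x; rewrite inE.
have /imsetP[s sS' xs] : pi x \in pi @: S by rewrite piS inE.
by rewrite -(subrK s x) subringD // mS // eq_mod_m.
Qed.

(* With [C] the largest ideal of [R] contained in [S] and [L] minimal above
   [C], maximality gives [S + L = R], while [m L] lies in [C]. *)
Lemma max_subring_msq_pR (S : {set R}) :
  is_max_subring S -> pi @: S = setT -> J \subset S.
Proof.
case/is_max_subringP=> sS nS maxS piS.
pose C := [set x | [forall r, r * x \in S]].
have CP x : reflect (forall r, r * x \in S) (x \in C).
  by rewrite inE; apply: forallP.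
have CS x : x \in C -> x \in S by move/CP/(_ 1); rewrite mul1r.
have iC : is_ideal C.
  apply/is_idealP; split=> [|x y /CP xC /CP yC|r x /CP xC]; apply/CP => s.
  - by rewrite mulr0 subring0.
  - by rewrite mulrDr subringD.
  - by rewrite mulrA.
have nC : setT != C.
  by apply: contraNneq nS => eC; rewrite -subTset eC; apply/subsetP.
have PT : [&& is_ideal [set: R], C \subset [set: R] & [set: R] != C].
  by rewrite is_ideal_setT subsetT.
have [L /minsetP[/and3P[iL sCL nLC] minL] _] :=
  @minset_exists _ (fun L => [&& is_ideal L, C \subset L & L != C]) _ PT.
have mL x y : x \in m -> y \in L -> x * y \in C.
  apply: adjacent_ideals_mul => //; [exact: mI | exact: one_sub_unit |].
  move=> I iI sCI sIL; have [->|nIC] := eqVneq I C; [by left | right].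
  by apply: minL; rewrite // iI sCI.
have SL x : exists2 s, s \in S & x - s \in L.
  pose T := [set x | [exists s in S, x - s \in L]].
  have TP z : reflect (exists2 s, s \in S & z - s \in L) (z \in T).
    by rewrite inE; apply: exists_inP.
  have sT : is_subring T.
    apply/is_subringP; split.
    - by apply/TP; exists 1; rewrite ?subring1 ?subrr ?mem_ideal0.
    - move=> y z /TP[s sS' ys] /TP[t tS zt]; apply/TP; exists (s - t).
        by rewrite subringB.
      have -> : y - z - (s - t) = (y - s) - (z - t) by ring.
      exact: mem_idealB.
    - move=> y z /TP[s sS' ys] /TP[t tS zt]; apply/TP; exists (s * t).
        by rewrite subringM.
      have -> : y * z - s * t = z * (y - s) + s * (z - t) by ring.
      by apply: mem_idealD => //; apply: mem_idealMl.
  have sST : S \subset T.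
    by apply/subsetP=> s sS'; apply/TP; exists s; rewrite ?subrr ?mem_ideal0.
  suff eT : T = setT by apply/TP; rewrite eT inE.
  (* If S + L were [S], the ideal [L] would lie in [S], hence in [C], against its choice. *)
  have [eT|//] := maxS T sT sST; case/negP: nLC; rewrite eqEsubset sCL andbT.
  apply/subsetP=> l lL; apply/CP=> r; rewrite -eT; apply/TP; exists 0.
    exact: subring0.
  by rewrite subr0 mem_idealMl.
(* A unit in [L] would put [m] into [C], as mL lies in [C]; then [S] would contain [m] and be all of
   [R]. *)
have sLm : L \subset m.
  apply/subsetP=> l lL; apply: contraNT nS => /local_unit[z lz].
  apply/eqP/m_sub_full => //; apply/subsetP=> x xm.
  by apply: CS; rewrite -(mulr1 x) -lz mulrA mem_idealMr ?mL.
apply: subset_trans (_ : C \subset S); last exact/subsetP.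
(* Write x and y as elements of [S] plus elements of [L]. Since [L] lies in [m], every correction
   term is in mL, hence in [C]. *)
have mmS x y : x \in m -> y \in m -> x * y \in S.
  move=> xm ym; have [s sS' xs] := SL x; have [t tS yt] := SL y.
  have -> : x * y = s * t + (y * (x - s) + x * (y - t) - (x - s) * (y - t)).
    by ring.
  apply: subringD; rewrite ?subringM //; apply: CS.
  apply: mem_idealB; rewrite ?mL ?(subsetP sLm) //; apply: mem_idealD; rewrite ?mL //.
apply: msq_pR_min => // [x y xm ym|]; apply/CP=> r.
  by rewrite mulrA mmS // mem_idealMl // mI.
have [s sS' rs] := SL r; rewrite -(subrK s r) mulrDl subringD //.
  by apply: CS; rewrite mulrC mL // natr_p_in_m.
by rewrite subringM // subring_nat.
Qed.

End LocalRing.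

(** * The space m / J and the derivation with values in it *)

Section Cotangent.

Variables (R : finComNzRingType) (m J : {set R}).
Variables (K : finFieldType) (pi : {rmorphism R -> K}).
Hypotheses (pi_surj : forall y : K, exists x : R, pi x = y)
  (pi_ker : forall x : R, (pi x == 0) = (x \in m)).
Hypotheses (mI : is_ideal m) (JI : is_ideal J) (sJm : J \subset m).
Hypothesis mmJ : forall x y, x \in m -> y \in m -> x * y \in J.
Implicit Types (x y z r : R).

Let eq_m x y : pi x = pi y -> x - y \in m.
Proof. by move=> xy; rewrite -pi_ker rmorphB xy subrr. Qed.

(** An arbitrary section [s] of [pi] is additive and multiplicative modulo m; as m^2 lies in [J],
    combinations with coefficients lifted by [s] are linear modulo [J]. A maximal independent family
    then gives the coordinates. *)
Lemma cotangent_coordinates : exists k (c : R -> 'rV[K]_k),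
  [/\ {in m &, forall x y, c (x + y) = c x + c y},
      forall r, {in m, forall x, c (r * x) = pi r *: c x},
      forall v, exists2 x, x \in m & c x = v
    & {in m, forall x, (c x == 0) = (x \in J)}].
Proof.
have [s sK] := fin_all_exists pi_surj.
pose Phi k (e : 'I_k -> R) (v : 'rV[K]_k) := \sum_i s (v 0 i) * e i.
pose indep k (e : 'I_k -> R) := forall v, Phi k e v \in J -> v = 0.
pose spans k (e : 'I_k -> R) := forall x, x \in m -> exists v, x - Phi k e v \in J.
have PhiD k (e : 'I_k -> R) v w : (forall i, e i \in m) ->
    Phi k e (v + w) - (Phi k e v + Phi k e w) \in J.
  move=> em; rewrite -big_split -sumrB /=; apply: ideal_sum => // i.
  rewrite mxE -mulrDl -mulrBl mmJ // eq_m //.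
  by rewrite rmorphD !sK.
have PhiZ k (e : 'I_k -> R) r v : (forall i, e i \in m) ->
    Phi k e (pi r *: v) - r * Phi k e v \in J.
  move=> em; rewrite mulr_sumr -sumrB /=; apply: ideal_sum => // i.
  rewrite mxE mulrA -mulrBl mmJ // eq_m //.
  by rewrite rmorphM !sK.
have Phim k (e : 'I_k -> R) v : (forall i, e i \in m) -> Phi k e v \in m.
  by move=> em; apply: ideal_sum => // i; apply: mem_idealMl.
have Phi_inj k (e : 'I_k -> R) v w : (forall i, e i \in m) -> indep k e ->
    Phi k e v - Phi k e w \in J -> v = w.
  move=> em inde vwJ; apply/subr0_eq/inde.
  have := PhiD k e (v - w) w em; rewrite subrK => H.
  have -> : Phi k e (v - w) = Phi k e v - Phi k e w
     - (Phi k e v - (Phi k e (v - w) + Phi k e w)) by ring.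
  exact: mem_idealB.
have [k [e [em inde spe]]] : exists k (e : 'I_k -> R),
    [/\ forall i, e i \in m, indep k e & spans k e].
  (* An independent family of length k yields |K|^k distinct elements of [m], and k < |K|^k, so
     extending it must stop. *)
  have [d] := ubnP (#|m|).
  suff: forall d k (e : 'I_k -> R), (forall i, e i \in m) -> indep k e ->
      (#|m| < k + d)%N -> exists k (e : 'I_k -> R),
      [/\ forall i, e i \in m, indep k e & spans k e].
    move/(_ d 0%N (fun i => 0)) => H md; apply: H => //.
      by move=> i; apply: mem_ideal0.
    by move=> v _; apply/rowP=> -[].
  elim=> [|{}d IHd] k e em inde mk.
    have : (#|K| ^ k <= #|m|)%N.
      rewrite -[k]mul1n -card_mx -cardsT.
      rewrite -(card_in_imset (f := Phi k e)); last first.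
        by move=> v w _ _ vw; apply: Phi_inj inde _ => //; rewrite vw subrr mem_ideal0.
      by apply: subset_leq_card; apply/subsetP=> _ /imsetP[v _ ->]; apply: Phim.
    rewrite leqNgt (leq_trans mk) // addn0 ltnW // ltn_expl //.
    exact: finNzRing_gt1.
  have [/forall_inP sp|] := boolP [forall x in m, [exists v, x - Phi k e v \in J]].
    by exists k, e; split=> // x xm; apply/existsP/sp.
  rewrite negb_forall_in => /exists_inP[x xm]; rewrite negb_exists => /forallP nx.
  pose e' (i : 'I_k.+1) := oapp e x (unlift ord0 i).
  apply: (IHd k.+1 e'); last by rewrite addSnnS.
    by move=> i; rewrite /e'; case: (unlift ord0 i) => //=.
  move=> v vJ; pose w := \row_i v 0 (lift ord0 i).
  have {}vJ : s (v 0 0) * x + Phi k e w \in J.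
    suff <- : Phi k.+1 e' v = s (v 0 0) * x + Phi k e w by [].
    rewrite /Phi big_ord_recl /e' unlift_none /=; congr (_ + _).
    by apply: eq_bigr => i _; rewrite liftK mxE.
  have [v0|nv0] := eqVneq (v 0 0) 0.
    have w0 : w = 0.
      apply: inde; rewrite -[Phi _ _ _](addKr (s (v 0 0) * x)) addrC mem_idealB //.
      by rewrite mmJ // -pi_ker sK v0.
    apply/rowP=> i; rewrite mxE; case: (unliftP ord0 i) => [j|] -> //.
    by have /rowP/(_ j) := w0; rewrite !mxE.
  (* A nonzero coefficient on the new vector x can be inverted modulo m, which would put x in the
     span of the old family. *)
  pose b := s (v 0 0)^-1; case/negP: (nx (pi (- b) *: w)).
  have -> : x - Phi k e (pi (- b) *: w) = b * (s (v 0 0) * x + Phi k e w)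
     - (b * s (v 0 0) - 1) * x - (Phi k e (pi (- b) *: w) - (- b) * Phi k e w).
    by ring.
  apply: mem_idealB => //; last exact: PhiZ.
  apply: mem_idealB => //; first exact: mem_idealMl.
  rewrite mmJ // eq_m //.
  by rewrite rmorphM rmorph1 !sK mulVf.
(* The implication makes [c] total, with arbitrary values outside [m]. *)
have /fin_all_exists[c cP] x : exists v, x \in m -> x - Phi k e v \in J.
  have [xm|_] := boolP (x \in m); last by exists 0.
  by have [v vP] := spe x xm; exists v.
have cE x v : x \in m -> x - Phi k e v \in J -> c x = v.
  move=> xm xv; apply: Phi_inj inde _ => //.
  have -> : Phi k e (c x) - Phi k e v = x - Phi k e v - (x - Phi k e (c x)) by ring.
  by rewrite mem_idealB ?cP.
exists k, c; split.
- move=> x y xm ym; apply: cE; first exact: mem_idealD.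
  have -> : x + y - Phi k e (c x + c y) = (x - Phi k e (c x)) + (y - Phi k e (c y))
    - (Phi k e (c x + c y) - (Phi k e (c x) + Phi k e (c y))) by ring.
  by rewrite mem_idealB ?PhiD // mem_idealD ?cP.
- move=> r x xm; apply: cE; first exact: mem_idealMl.
  have -> : r * x - Phi k e (pi r *: c x) = r * (x - Phi k e (c x))
    - (Phi k e (pi r *: c x) - r * Phi k e (c x)) by ring.
  by rewrite mem_idealB ?PhiZ // mem_idealMl ?cP.
- move=> v; exists (Phi k e v); first exact: Phim.
  by apply: cE; rewrite ?Phim // subrr mem_ideal0.
- have P0 : Phi k e 0 \in J.
    apply: ideal_sum => // i; rewrite mxE mmJ //.
    by rewrite -pi_ker sK.
  move=> x xm; apply/eqP/idP => [cx0|xJ].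
    by have := cP x xm; rewrite cx0 => /mem_idealBr->.
  by apply: cE => //; apply: mem_idealB.
Qed.

Variables (p n : nat).
Hypotheses (p_pr : prime p) (cardK : #|K| = (p ^ n)%N) (pJ : p%:R \in J).
Local Notation q := #|K|.

Variables (k : nat) (c : R -> 'rV[K]_k).
Hypotheses (cD : {in m &, forall x y, c (x + y) = c x + c y})
  (cZ : forall r, {in m, forall x, c (r * x) = pi r *: c x})
  (c_surj : forall v, exists2 x, x \in m & c x = v)
  (c_ker : {in m, forall x, (c x == 0) = (x \in J)}).

Let cB : {in m &, forall x y, c (x - y) = c x - c y}.
Proof.
move=> x y xm ym; rewrite cD ?mem_idealN // -[- y]mulN1r cZ // rmorphN1.
by rewrite scaleN1r.
Qed.

Let c_mod x y : x \in m -> y \in m -> x - y \in J -> c x = c y.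
Proof. by move=> xm ym xy; apply/subr0_eq/eqP; rewrite -cB // c_ker // mem_idealB. Qed.

(** The theorem gives [rho] by an equation of this shape, so the count identifies k with [rho]. *)
Lemma card_by_coordinates : #|m| = (q ^ k * #|J|)%N.
Proof.
rewrite (@card_additive_on _ _ m c _ cB); last by move=> x y; apply: mem_idealB.
congr (_ * _)%N.
  rewrite -[k in RHS]mul1n -card_mx -cardsT; apply: eq_card => v; rewrite inE.
  by have [x xm <-] := c_surj v; rewrite imset_f.
apply: eq_card => x; rewrite inE; have [xm|xm] := boolP (x \in m).
  by rewrite /= c_ker.
by apply/esym/negbTE; apply: contra xm; apply: (subsetP sJm).
Qed.

Let frob_m x : x - x ^+ q \in m.
Proof. by rewrite eq_m // rmorphXn /= expf_card. Qed.

Let frobD x y : (x + y) ^+ q - (x ^+ q + y ^+ q) \in J.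
Proof.
rewrite cardK; have [t ->] := exprD_prime_power_mod n x y p_pr.
by rewrite addrC addKr mem_idealMr.
Qed.

Let frob_J x : x \in m -> x ^+ q \in J.
Proof.
have := finNzRing_gt1 K; case: q => [|[|k']] // _ xm.
by rewrite !exprS mulrA mem_idealMr ?mmJ.
Qed.

Let mJ x : x \in J -> x \in m. Proof. exact: (subsetP sJm). Qed.

(* Through the coordinates [c], a derivation of [R] into [m / J]. *)
Definition teich_der x := c (x - x ^+ q).
Local Notation D := teich_der.

(** As q >= 2, x^q is a multiple of x^2, hence in [J]. Thus D extends the coordinates, which makes
    it surjective already on [m]. *)
Lemma teich_der_m x : x \in m -> D x = c x.
Proof.
move=> xm; apply: c_mod => //.
by rewrite addrC addKr mem_idealN ?frob_J.
Qed.

Lemma teich_derD x y : D (x + y) = D x + D y.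
Proof.
rewrite /D -cD //; apply: c_mod => //; first exact: mem_idealD.
have -> : x + y - (x + y) ^+ q - (x - x ^+ q + (y - y ^+ q))
  = - ((x + y) ^+ q - (x ^+ q + y ^+ q)) by ring.
by rewrite mem_idealN.
Qed.

(** xy - (xy)^q = x(y - y^q) + y^q(x - x^q), and y^q has the same residue as y. *)
Lemma teich_derM x y : D (x * y) = pi x *: D y + pi y *: D x.
Proof.
rewrite /D -[pi y]expf_card -rmorphXn -!cZ // -cD ?mem_idealMl //.
by congr c; rewrite exprMn; ring.
Qed.

Lemma teich_derB x y : D (x - y) = D x - D y.
Proof. by apply: (addIr (D y)); rewrite -teich_derD !subrK. Qed.

Lemma teich_der1 : D 1 = 0.
Proof. by rewrite /D expr1n subrr; apply/eqP; rewrite c_ker ?mem_ideal0. Qed.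

(** Raise x = x^q + (x - x^q) to the power q: modulo [J] the second term disappears, being in [m].
    So the kernels below contain all q-th powers, which represent every residue. *)
Lemma teich_der_expq x : D (x ^+ q) = 0.
Proof.
apply/eqP; rewrite /D c_ker //.
have := frobD (x ^+ q) (x - x ^+ q); rewrite [x ^+ q + _]addrC subrK => H.
have -> : x ^+ q - x ^+ q ^+ q = x ^+ q - (x ^+ q ^+ q + (x - x ^+ q) ^+ q)
  + (x - x ^+ q) ^+ q by ring.
by rewrite mem_idealD // frob_J.
Qed.

Definition der_ring (u : 'cV[K]_k) : {set R} := [set x | D x *m u == 0].

Lemma der_ringP u x : reflect (D x *m u = 0) (x \in der_ring u).
Proof. by rewrite inE; apply: eqP. Qed.

Lemma der_ring_subring u : is_subring (der_ring u).
Proof.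
apply/is_subringP; split; first by apply/der_ringP; rewrite teich_der1 mul0mx.
  move=> x y /der_ringP x0 /der_ringP y0; apply/der_ringP.
  by rewrite teich_derB mulmxBl x0 y0 subrr.
move=> x y /der_ringP x0 /der_ringP y0; apply/der_ringP.
by rewrite teich_derM mulmxDl -!scalemxAl x0 y0 !scaler0 addr0.
Qed.

Lemma im_der_ring u : pi @: der_ring u = setT.
Proof.
apply/setP=> y; rewrite inE; have [x xy] := pi_surj y.
apply/imsetP; exists (x ^+ q); last by rewrite rmorphXn xy expf_card.
by apply/der_ringP; rewrite teich_der_expq mul0mx.
Qed.

Lemma functional_surj (u : 'cV[K]_k) a : u != 0 -> exists v : 'rV_k, v *m u = a%:M.
Proof.
move=> nu; have [i ni] : exists i, u i 0 != 0.
  apply/existsP; apply: contraNT nu; rewrite negb_exists => /forallP u0.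
  by apply/eqP/colP=> i; have /negPn/eqP := u0 i; rewrite mxE.
exists ((a / u i 0) *: delta_mx 0 i).
rewrite -scalemxAl -rowE; apply/rowP=> j; rewrite ord1 !mxE.
by rewrite divfK // mulr1n.
Qed.

Lemma teich_der_functional_surj u a : u != 0 ->
  exists2 x, x \in m & D x *m u = a%:M.
Proof.
case/(functional_surj a)=> v <-; have [x xm xv] := c_surj v.
by exists x; rewrite // teich_der_m ?xv.
Qed.

Lemma der_ring_max u : u != 0 -> is_max_subring (der_ring u).
Proof.
move=> nu; apply/is_max_subringP; split; first exact: der_ring_subring.
  have [x _ Dx] := teich_der_functional_surj 1 nu.
  apply/eqP=> eT; have /der_ringP : x \in der_ring u by rewrite eT.
  by rewrite Dx => /matrixP/(_ 0 0)/eqP; rewrite !mxE /= (negPf (oner_neq0 _)).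
move=> T sT sST; have [sTS|/subsetPn[t tT tS]] := boolP (T \subset der_ring u).
  by left; apply/eqP; rewrite eqEsubset sTS.
right; apply/setP=> x; rewrite inE.
have Dt : D t *m u != 0 by apply/eqP=> /der_ringP; apply/negP.
(* If s is in the kernel, Leibniz gives uD(st) = pi(s) uD(t); with residue [a], the element s makes
   x - st fall into the kernel. *)
pose a := (D x *m u) 0 0 / (D t *m u) 0 0.
have [s sS pis] : exists2 s, s \in der_ring u & pi s = a.
  have : a \in pi @: der_ring u by rewrite im_der_ring inE.
  by case/imsetP=> s sS as_; exists s.
rewrite -(subrK (s * t) x) subringD //; last first.
  by rewrite subringM // (subsetP sST).
apply/(subsetP sST)/der_ringP.
rewrite teich_derB teich_derM mulmxBl mulmxDl -!scalemxAl (der_ringP _ _ sS).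
rewrite scaler0 addr0 pis; apply/matrixP=> i j; rewrite !ord1 !mxE.
rewrite -/(_ 0 0); set A := \sum_j _; set B := \sum_j _.
have -> : a = A / B by rewrite /a !mxE.
rewrite divfK ?subrr //; apply: contraNneq Dt => B0.
by apply/eqP/matrixP=> i' j'; rewrite !ord1 mxE -/B B0 mxE.
Qed.

Lemma card_der_ring u : u != 0 -> #|R| = (q * #|der_ring u|)%N.
Proof.
move=> nu; pose f x := (D x *m u) 0 0.
rewrite -cardsT (@card_additive_on _ _ setT f).
- congr (_ * _)%N.
    rewrite -cardsT; apply: eq_card => a; rewrite inE; apply/imsetP.
    have [x _ Dx] := teich_der_functional_surj a nu.
    by exists x; rewrite ?inE // /f Dx mxE.
  apply: eq_card => x; rewrite !inE /=; apply/eqP/eqP=> [fx|Dx].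
    by apply/matrixP=> i j; rewrite !ord1 [RHS]mxE.
  by rewrite /f Dx mxE.
- by move=> x y; rewrite !inE.
- by move=> x y _ _; rewrite /f teich_derB mulmxBl !mxE.
Qed.

(** [W] is stable under scalars because pi(S) = K, and proper because otherwise [S], which contains
    [J], would contain [m]. A form killing [W] kills D(S), as x - x^q is in [S] and [m]; maximality
    does the rest. *)
Lemma max_subring_der_ring S : is_max_subring S -> pi @: S = setT ->
  J \subset S -> exists2 u, u != 0 & S = der_ring u.
Proof.
move=> maxS piS /subsetP JS; have [sS nS minS] := is_max_subringP _ maxS.
pose W := c @: (S :&: m).
have Wc x : x \in S -> x \in m -> c x \in W by move=> xS xm; rewrite imset_f ?inE ?xS.
have [|v w|a v||u nu uW] := @proper_subspace_hyperplane K k W.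
- have <- : c 0 = 0 by apply/eqP; rewrite c_ker ?mem_ideal0.
  by apply: Wc; [exact: subring0 | exact: mem_ideal0].
- move=> /imsetP[x /setIP[xS xm] ->] /imsetP[y /setIP[yS ym] ->].
  by rewrite -cD //; apply: Wc; [exact: subringD | exact: mem_idealD].
- move=> /imsetP[x /setIP[xS xm] ->].
  have /imsetP[s sS' ->] : a \in pi @: S by rewrite piS inE.
  by rewrite -cZ //; apply: Wc; [exact: subringM | exact: mem_idealMl].
- apply: contraNneq nS => WT; apply/eqP/setP=> x; rewrite inE.
  have mS y : y \in m -> y \in S.
    move=> ym; have : c y \in W by rewrite WT inE.
    case/imsetP=> z /setIP[zS zm] cyz; rewrite -(subrK z y) subringD // JS //.
    by rewrite -c_ker ?mem_idealB // cB // cyz subrr.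
  have /imsetP[s sS' xs] : pi x \in pi @: S by rewrite piS inE.
  by rewrite -(subrK s x) subringD // mS // eq_m.
exists u => //; have sSu : S \subset der_ring u.
  apply/subsetP=> x xS; apply/der_ringP/uW/Wc => //.
  by rewrite subringB // subringX.
have [//|eT] := minS _ (der_ring_subring u) sSu.
by have [] := is_max_subringP _ (der_ring_max nu); rewrite eT eqxx.
Qed.

Lemma der_ring_eq u u' : u != 0 -> der_ring u = der_ring u' ->
  exists a, u' = a *: u.
Proof.
move=> nu eS; have [v vu] := functional_surj 1 nu.
exists ((v *m u') 0 0); apply/colP=> i.
(* The i-th basis vector projected along [v] to the kernel of [u]; that [u'] kills it reads off the
   i-th entry of [u']. *)
pose w : 'rV[K]_k := delta_mx 0 i - u i 0 *: v.
have [x xm cx] := c_surj w.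
have : x \in der_ring u.
  apply/der_ringP; rewrite teich_der_m // cx mulmxBl -scalemxAl vu -rowE.
  by apply/matrixP=> a b; rewrite !ord1 !mxE mulr1n mulr1 subrr.
rewrite eS => /der_ringP; rewrite teich_der_m // cx mulmxBl -scalemxAl -rowE.
move=> /matrixP/(_ 0 0); rewrite !mxE => /subr0_eq ->.
by rewrite mulrC.
Qed.

Lemma der_ringZ u a : a != 0 -> der_ring (a *: u) = der_ring u.
Proof.
by move=> na; apply/setP=> x; rewrite !inE -scalemxAr scaler_eq0 (negPf na).
Qed.

(** The fibres of u |-> [der_ring u] are lines without 0, of q - 1 elements each: the rings are the
    points of a projective space. *)
Lemma card_der_rings :
  #|der_ring @: [set u : 'cV[K]_k | u != 0]| = ((q ^ k - 1) %/ (q - 1))%N.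
Proof.
have q1 := finNzRing_gt1 K.
suff <- : (#|der_ring @: [set u : 'cV[K]_k | u != 0%R]| * (q - 1) = q ^ k - 1)%N.
  by rewrite mulnK // subn_gt0.
rewrite -sum_nat_const.
have -> : (q ^ k - 1 = #|[set u : 'cV[K]_k | u != 0%R]|)%N.
  rewrite -[k in LHS]muln1 -card_mx -cardsT (cardsD1 0) inE add1n subn1 /=.
  by apply: eq_card => u; rewrite !inE andbT.
rewrite -[RHS]sum1_card (partition_big_imset der_ring) /=.
apply: eq_bigr => _ /imsetP[u nu ->]; rewrite inE in nu.
rewrite sum1dep_card.
have -> : (q - 1 = #|[set a : K | a != 0%R]|)%N.
  rewrite -[q]cardsT (cardsD1 0) inE add1n subn1 /=.
  by apply: eq_card => a; rewrite !inE andbT.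
have inj : injective (fun a : K => a *: u).
  by move=> a b /eqP; rewrite -subr_eq0 -scalerBl scaler_eq0 (negPf nu) orbF
    subr_eq0 => /eqP.
rewrite -(card_imset _ inj); apply: eq_card => u'; rewrite [RHS]inE.
apply/imsetP/andP => [[a]|[]].
  by rewrite inE => na ->; rewrite inE scaler_eq0 negb_or na nu der_ringZ.
rewrite inE => nu' /eqP/esym/(der_ring_eq nu)[a ea].
by exists a; rewrite // inE; apply: contraNneq nu' => a0; rewrite ea a0 scale0r.
Qed.

End Cotangent.

(** Nakayama by finiteness: if pR were smaller than [m], an ideal [L] maximal among those above pR
    and properly inside [m] would contain m^2 by adjacency, hence all of J = m. *)
Lemma msq_pR_full_principal (R : finComNzRingType) (m : {set R}) (p : nat) x :
  is_max_ideal m -> (forall J : {set R}, is_max_ideal J -> J = m) ->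
  p%:R \in m -> msq_pR m p = m -> x \in m -> exists y, x = p%:R * y.
Proof.
move=> Hm Hloc pm eJ xm; have mI := max_ideal_ideal Hm.
have i0 : is_ideal [set (0 : R)].
  by apply/is_idealP; split=> [|y z|y z]; rewrite !inE // => /eqP->;
     [rewrite add0r | rewrite mulr0].
pose P := ideal_adj [set (0 : R)] p%:R.
have iP : is_ideal P by apply: ideal_adj_ideal.
suff : x \in P.
  by case/ideal_adjP=> y; rewrite inE subr_eq0 => /eqP->; exists y; rewrite mulrC.
apply/negPn/negP=> xP.
have sP : P \subset m.
  by apply: ideal_adj_min => //; apply/subsetP=> y /set1P->; apply: mem_ideal0.
have PP : [&& is_ideal P, P \subset m & P != m].
  by rewrite iP sP; apply: contraNneq xP => ->.
have [L /maxsetP[/and3P[iL sLm nLm] maxL] sPL] :=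
  @maxset_exists _ (fun L => [&& is_ideal L, L \subset m & L != m]) _ PP.
case/negP: nLm; rewrite eqEsubset sLm -{1}eJ; apply: msq_pR_min => //.
  apply: adjacent_ideals_mul => //; first exact: one_sub_unit.
  move=> I iI sLI sIm; have [->|nIm] := eqVneq I m; [by right | left].
  by apply: maxL; rewrite // iI sIm.
by apply: (subsetP sPL); apply: mem_ideal_adj.
Qed.

(** Both ['Z_k] and ['F_p] unfold to this ordinal type, so one construction covers the reduction and
    the maps into R and K. *)
Lemma ord_natr_rmorphism (A : comNzRingType) M : M.+2%:R = 0 :> A ->
  exists f : {rmorphism 'I_M.+2 -> A}, forall c, f c = (val c)%:R.
Proof.
move=> M0; pose f (c : 'I_M.+2) : A := (val c)%:R.
have f_mod i : (i %% M.+2)%:R = i%:R :> A.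
  by rewrite [in RHS](divn_eq i M.+2) natrD natrM M0 mulr0 add0r.
have fD : {morph f : x y / x + y} by move=> x y; rewrite /f /= f_mod natrD.
have fB : zmod_morphism f.
  by move=> x y; apply: (addIr (f y)); rewrite -fD !subrK.
have fM : monoid_morphism f.
  by split=> [|x y]; rewrite /f //= f_mod natrM.
pose F : {rmorphism 'I_M.+2 -> A} := HB.pack_for {rmorphism 'I_M.+2 -> A} f
  (GRing.isZmodMorphism.Build _ _ f fB) (GRing.isMonoidMorphism.Build _ _ f fM).
by exists F.
Qed.

(** * Reduction of coefficients modulo p *)

Section Reduction.

Variables (p N : nat).
Hypotheses (p_pr : prime p) (N_gt0 : (0 < N)%N).

Let pN_gt1 : (1 < p ^ N)%N.
Proof. by rewrite -(exp1n N) ltn_exp2r ?prime_gt1. Qed.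

Let F_p0 : p%:R = 0 :> 'F_p.
Proof. by have /andP[_ /eqP] := pchar_Fp p_pr. Qed.

Lemma reduction_rmorphism :
  exists f : {rmorphism 'Z_(p ^ N) -> 'F_p}, forall c, f c = (val c)%:R.
Proof.
apply: ord_natr_rmorphism; rewrite Zp_cast //.
by rewrite -(prednK N_gt0) expnS natrM F_p0 mul0r.
Qed.

Lemma Zp_natr_rmorphism (A : comNzRingType) : (p ^ N)%:R = 0 :> A ->
  exists f : {rmorphism 'Z_(p ^ N) -> A}, forall c, f c = (val c)%:R.
Proof. by move=> A0; apply: ord_natr_rmorphism; rewrite Zp_cast. Qed.

Lemma Fp_natr_rmorphism (A : comNzRingType) : p%:R = 0 :> A ->
  exists f : {rmorphism 'F_p -> A}, forall c, f c = (val c)%:R.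
Proof. by move=> A0; apply: ord_natr_rmorphism; rewrite Fp_cast. Qed.

Variable red : {rmorphism 'Z_(p ^ N) -> 'F_p}.

Lemma reduction_lift (g : {poly 'F_p}) :
  exists2 G : {poly 'Z_(p ^ N)}, (size G <= size g)%N & map_poly red G = g.
Proof.
exists (\poly_(i < size g) (val g`_i)%:R); first exact: size_poly.
apply/polyP=> i; rewrite coef_map coef_poly /=.
case: ltnP => [_|ig]; first by rewrite rmorph_nat natr_Zp.
by rewrite rmorph0 nth_default.
Qed.

Lemma reduction_eq0 (G : {poly 'Z_(p ^ N)}) : map_poly red G = 0 ->
  exists2 H : {poly 'Z_(p ^ N)}, (size H <= size G)%N & G = p%:R *: H.
Proof.
move=> G0; exists (\poly_(i < size G) (val (G`_i)%R %/ p)%:R).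
  exact: size_poly.
apply/polyP=> i; rewrite coefZ coef_poly; case: ltnP => [_|iG]; last first.
  by rewrite mulr0 nth_default.
have pG : (p %| val (G`_i)%R)%N.
  rewrite (dvdn_pcharf (pchar_Fp p_pr)) -(rmorph_nat red) natr_Zp.
  by apply/eqP; have /polyP/(_ i) := G0; rewrite coef_map coef0.
by rewrite -natrM mulnC divnK // natr_Zp.
Qed.

End Reduction.

(** * Recognition of Galois rings *)

Section GaloisRing.

Variables (p N n : nat) (K : finFieldType).
Hypotheses (p_pr : prime p) (N_gt0 : (0 < N)%N) (n_gt0 : (0 < n)%N).
Hypothesis cardK : #|K| = (p ^ n)%N.
Variables (theta : K) (j : {rmorphism 'F_p -> K}).
Hypothesis theta_gen : forall y, y != 0 -> exists k, y = theta ^+ k.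

Local Notation ev g := (map_poly j g).[theta].

Implicit Types (g : {poly 'F_p}) (y : K).

(** Each element of [K] is 0 or a power of [theta], hence the value at [theta] of a remainder modulo
    g. Counting remainders bounds the degree of g from below by n. *)
Lemma gen_root_size g : g != 0 -> ev g = 0 -> (n < size g)%N.
Proof.
move=> ng g0; have sg : (0 < size g)%N by rewrite size_poly_gt0.
pose f (h : {poly_(size g).-1 'F_p}) := ev (h : {poly 'F_p}).
have fsurj y : y \in [set f h | h : {poly_(size g).-1 'F_p}].
  have [h hy] : exists h : {poly 'F_p}, y = ev h.
    have [->|/theta_gen[k ->]] := eqVneq y 0; first by exists 0; rewrite rmorph0 horner0.
    by exists 'X^k; rewrite map_polyXn hornerXn.
  apply/imsetP; exists (npolyp _ (h %% g)) => //.
  rewrite /f npolypK; last by rewrite -ltnS prednK // ltn_modp.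
  by rewrite hy {1}(divp_eq h g) rmorphD rmorphM hornerD hornerM g0 mulr0 add0r.
have : (#|K| <= #|[set f h | h : {poly_(size g).-1 'F_p}]|)%N.
  by rewrite -cardsT; apply: subset_leq_card; apply/subsetP=> y _.
move/leq_trans/(_ (leq_imset_card _ _)); rewrite cardT -cardE card_npoly card_Fp //.
by rewrite cardK leq_exp2l ?prime_gt1 // -ltnS prednK.
Qed.

Lemma gen_small_surj y : exists2 g : {poly 'F_p}, (size g <= n)%N & ev g = y.
Proof.
pose f (h : {poly_n 'F_p}) := ev (h : {poly 'F_p}).
have f_inj : injective f.
  move=> g h /eqP; rewrite -subr_eq0 -hornerN -hornerD -rmorphN -rmorphD => /eqP gh.
  apply: val_inj; apply/subr0_eq/eqP; apply: contraT => nz.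
  have := gen_root_size nz gh; rewrite ltnNge (leq_trans (size_polyD _ _)) //.
  by rewrite size_polyN geq_max !size_npoly.
have [|f' _ f'K] := inj_card_bij f_inj; first by rewrite card_npoly card_Fp // cardK.
by exists (f' y); rewrite ?size_npoly // -[RHS]f'K.
Qed.

(** In a factorization one factor vanishes at [theta], so it has degree at least n and the other is
    constant. *)
Lemma gen_root_irreducible g : size g = n.+1 -> ev g = 0 -> irreducible_poly g.
Proof.
move=> sg g0; have ng : g != 0 by rewrite -size_poly_gt0 sg.
split=> [|d nd dg]; first by rewrite sg.
have [e ge] := dvdpP _ _ dg.
have ne : e != 0 by apply: contraNneq ng => e0; rewrite ge e0 mul0r.
have nd0 : d != 0 by apply: contraNneq ng => d0; rewrite ge d0 mulr0.
have sed : (size e + size d = n.+2)%N.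
  have := size_mul ne nd0; rewrite -ge sg => ->; rewrite prednK //.
  by rewrite addn_gt0 size_poly_gt0 ne.
move/eqP: g0; rewrite ge rmorphM hornerM mulf_eq0 => /orP[]/eqP.
  move/(gen_root_size ne) => se; case/negP: nd; rewrite eqn_leq size_poly_gt0 nd0.
  by rewrite -(leq_add2l (size e)) sed addn1 ltnS se.
move/(gen_root_size nd0) => sd; rewrite -ge -dvdp_size_eqp // sg.
rewrite eqn_leq sd andbT -(leq_add2l (size e)) sed.
by rewrite -addn1 addnC leq_add // size_poly_gt0.
Qed.

Variables (R : finComNzRingType) (m : {set R}) (pi : {rmorphism R -> K}).
Hypothesis pi_ker : forall x : R, (pi x == 0) = (x \in m).
Hypothesis m_unit : forall x : R, x \notin m -> exists z, x * z = 1.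
Hypothesis m_pR : forall x : R, x \in m -> exists z, x = p%:R * z.
Hypotheses (Hchar : (p ^ N)%:R = 0 :> R) (Hchar' : (p ^ N.-1)%:R != 0 :> R).
Variables (a : R) (pi_a : pi a = theta).
Variables (red : {rmorphism 'Z_(p ^ N) -> 'F_p}) (iota : {rmorphism 'Z_(p ^ N) -> R}).
Hypothesis pi_iota : forall c, pi (iota c) = j (red c).

Local Notation Ev G := (map_poly iota G).[a].
Local Notation "G ^r" := (map_poly red G) (at level 2, format "G ^r").

Implicit Types (G : {poly 'Z_(p ^ N)}) (r : R).

Lemma pi_eval G : pi (Ev G) = ev G^r.
Proof.
rewrite -horner_map pi_a -!map_poly_comp; congr horner.
by apply: eq_map_poly => c; apply: pi_iota.
Qed.

(** Successive approximation: the error p^i r' is improved to a multiple of p^(i+1) by lifting the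
    residue of r', and it vanishes at i = N. *)
Lemma galois_eval_surj r : exists2 G : {poly 'Z_(p ^ N)}, (size G <= n)%N & Ev G = r.
Proof.
suff H i : exists (G : {poly 'Z_(p ^ N)}) r', (size G <= n)%N /\ r = Ev G + (p ^ i)%:R * r'.
  by have [G [r' [sG ->]]] := H N; exists G; rewrite // Hchar mul0r addr0.
elim: i => [|i [G [r' [sG ->]]]].
  by exists 0, r; rewrite size_poly0 rmorph0 horner0 add0r mul1r.
have [g sg gr] := gen_small_surj (pi r').
have [G' sG' eG'] := reduction_lift red g.
have [|r'' r'E] := @m_pR (r' - Ev G').
  by rewrite -pi_ker rmorphB pi_eval eG' gr subrr.
exists (G + (p ^ i)%:R *: G'), r''; split.
  rewrite (leq_trans (size_polyD _ _)) // geq_max sG (leq_trans (size_scale_leq _ _)) //.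
  exact: leq_trans sG' sg.
rewrite rmorphD /= linearZ /= rmorph_nat hornerD hornerZ expnSr natrM -mulrA -r'E.
by ring.
Qed.

(** Write G = p^i H. If H were nonzero modulo p, its value at [a] would be a unit by the degree
    bound, giving p^i = 0 in [R] with i < N. So one more p divides out, up to p^N = 0. *)
Lemma galois_eval_inj G : (size G <= n)%N -> Ev G = 0 -> G = 0.
Proof.
move=> sG G0.
suff H i : (i <= N)%N ->
    exists2 H : {poly 'Z_(p ^ N)}, (size H <= n)%N & G = (p ^ i)%:R *: H.
  have [H' _ ->] := H N (leqnn N).
  by rewrite pchar_Zp ?scale0r // -(exp1n N) ltn_exp2r ?prime_gt1.
elim: i => [_|i IHi iN]; first by exists G; rewrite ?scale1r.
have [H sH GH] := IHi (ltnW iN).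
have [/reduction_eq0[//|H' sH' HH']|nH] := eqVneq (H^r) 0.
  exists H'; first exact: leq_trans sH' sH.
  by rewrite GH HH' scalerA -natrM -expnSr.
have : Ev H \notin m.
  rewrite -pi_ker pi_eval; apply/eqP=> /(gen_root_size nH).
  by rewrite ltnNge (leq_trans _ sH) // size_poly.
case/m_unit=> z Hz; case/negP: Hchar'.
have pi0 : (p ^ i)%:R = 0 :> R.
  move: G0; rewrite GH linearZ /= rmorph_nat hornerZ => G0.
  by have := congr1 (fun t => t * z) G0; rewrite -mulrA Hz mulr1 mul0r.
have iN' : (i <= N.-1)%N by rewrite -ltnS prednK.
by rewrite -(subnK iN') expnD natrM pi0 mulr0.
Qed.

(** Expressing a^n by lower powers of [a] gives f. Evaluation at [a] is then a bijection from the
    quotient to [R], and the morphism asked for is its inverse. *)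
Lemma galois_ring_iso : exists f : {poly 'Z_(p ^ N)},
  [/\ f \is monic, size f = n.+1, irreducible_poly f^r
    & exists phi : {rmorphism R -> {poly %/ f}}, bijective phi].
Proof.
have [G sG Ga] := galois_eval_surj (a ^+ n).
pose f := 'X^n - G.
have sGX : (size (- G) < size ('X^n : {poly 'Z_(p ^ N)}))%N.
  by rewrite size_polyN size_polyXn.
have sf : size f = n.+1 by rewrite size_polyDl // size_polyXn.
have fm : f \is monic by rewrite monicE lead_coefDl // lead_coefXn.
have f0 : Ev f = 0 by rewrite rmorphB /= map_polyXn hornerD hornerN hornerXn Ga subrr.
(* The quotient is built on [mk_monic f], which is f itself only for f monic and nonconstant. *)
have mkf : mk_monic f = f by rewrite /mk_monic sf ltnS n_gt0 fm.
exists f; split=> //.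
  apply: gen_root_irreducible; last by rewrite -pi_eval f0 rmorph0.
  by rewrite size_map_poly_id0 // (monicP fm) rmorph1 oner_neq0.
have modE G' : Ev (Pdiv.CommonRing.rmodp G' (mk_monic f)) = Ev G'.
  rewrite mkf [in RHS](Pdiv.RingMonic.rdivp_eq fm G').
  by rewrite rmorphD rmorphM hornerD hornerM f0 mulr0 add0r.
pose psi (g : {poly %/ f}) := Ev (g : {poly 'Z_(p ^ N)}).
have psiB : {morph psi : g h / g - h}.
  by move=> g h; rewrite /psi /= rmorphB hornerD hornerN.
have psi1 : psi 1 = 1 by rewrite /psi /= rmorph1 hornerC.
have psiM : {morph psi : g h / g * h}.
  by move=> g h; rewrite /psi poly_of_qpolyM modE rmorphM hornerM.
have psi_inj : injective psi.
  move=> g h gh; apply/subr0_eq; apply: val_inj; apply: galois_eval_inj.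
    by apply: leq_trans (size_npoly (g - h)) _; rewrite mkf sf.
  by rewrite -/(psi (g - h)) psiB gh subrr.
have [phi phiK] : exists phi, cancel phi psi.
  have psi_surj r : exists h, psi h = r.
    have [H sH Hr] := galois_eval_surj r; exists (in_qpoly f H).
    by rewrite /psi in_qpoly_small // mkf sf ltnS.
  by have [phi phiK] := fin_all_exists psi_surj; exists phi.
have phiB : zmod_morphism phi by move=> x y; apply: psi_inj; rewrite psiB !phiK.
have phiM : monoid_morphism phi.
  by split=> [|x y]; apply: psi_inj; rewrite ?psiM ?psi1 !phiK.
pose Phi : {rmorphism R -> {poly %/ f}} := HB.pack_for {rmorphism R -> {poly %/ f}} phi
  (GRing.isZmodMorphism.Build _ _ phi phiB) (GRing.isMonoidMorphism.Build _ _ phi phiM).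
exists Phi; exists psi => // g; apply: psi_inj; exact: phiK.
Qed.

End GaloisRing.

(** Let g represent x. If g vanishes modulo p, then p divides x. Otherwise g is coprime to f modulo
    p, and lifting Bezout gives Uf + Vg = 1 + pH, which puts 1 in [m]. *)
Lemma galois_ring_principal (p N n : nat) (R : finComNzRingType) (m : {set R})
    (red : {rmorphism 'Z_(p ^ N) -> 'F_p}) (f : {poly 'Z_(p ^ N)})
    (phi : {rmorphism R -> {poly %/ f}}) (x : R) :
  prime p -> is_ideal m -> 1 \notin m -> p%:R \in m ->
  f \is monic -> size f = n.+1 -> irreducible_poly (map_poly red f) ->
  bijective phi -> x \in m -> exists y, x = p%:R * y.
Proof.
move=> p_pr mI m1 pm fm sf irrf [psi phiK psiK] xm.
have n_gt0 : (0 < n)%N.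
  have [+ _] := irrf; rewrite size_map_poly_id0 ?sf //.
  by rewrite (monicP fm) rmorph1 oner_neq0.
have mkf : mk_monic f = f by rewrite /mk_monic sf ltnS n_gt0 fm.
have phi_inj := can_inj phiK.
have qK g : in_qpoly f (g : {poly %/ f}) = g.
  by apply: val_inj; apply: in_qpoly_small (size_mk_monic _).
pose g : {poly 'Z_(p ^ N)} := phi x.
have natE (H : {poly 'Z_(p ^ N)}) : in_qpoly f (p%:R *: H) = phi (p%:R * psi (in_qpoly f H)).
  by rewrite rmorphM rmorph_nat psiK -mul_polyC rmorphM polyC_natr rmorph_nat.
have [/(reduction_eq0 p_pr)[H _ gH]|ng] := eqVneq (map_poly red g) 0.
  exists (psi (in_qpoly f H)); apply: phi_inj.
  by rewrite -natE -gH qK.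
case/negP: m1.
have cop : coprimep (map_poly red f) (map_poly red g).
  rewrite coprimep_sym; have [_ irr] := irrf.
  rewrite /coprimep; apply: contraT => nc.
  have := irr _ nc (dvdp_gcdr _ _); rewrite eqp_sym => /andP[fg _].
  have := dvdp_leq ng (dvdp_trans fg (dvdp_gcdl _ _)).
  rewrite size_map_poly_id0 ?sf; last by rewrite (monicP fm) rmorph1 oner_neq0.
  have sg : (size g <= n)%N by apply: leq_trans (size_npoly (phi x)) _; rewrite mkf sf.
  by rewrite leqNgt ltnS (leq_trans _ sg) // size_poly.
have [[u v] /= uv] := Bezout_eq1_coprimepP _ _ cop.
have [U _ eU] := reduction_lift red u; have [V _ eV] := reduction_lift red v.
have : map_poly red (U * f + V * g - 1) = 0.
  by rewrite rmorphB rmorphD !rmorphM rmorph1 /= eU eV uv subrr.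
case/(reduction_eq0 p_pr)=> H _ /eqP; rewrite subr_eq => /eqP eH.
have f0 : in_qpoly f f = 0.
  by apply: val_inj; rewrite /= mkf Pdiv.RingMonic.rmodpp.
have e1 : psi (in_qpoly f V) * x - p%:R * psi (in_qpoly f H) = 1.
  apply: phi_inj; rewrite rmorphB rmorph1 -natE rmorphM psiK.
  move/(congr1 (in_qpoly f)): eH; rewrite !rmorphD !rmorphM rmorph1 /= f0 mulr0 add0r.
  by rewrite qK => ->; rewrite addrC addKr.
by rewrite -e1; apply: mem_idealB => //; [apply: mem_idealMl | apply: mem_idealMr].
Qed.

Lemma finField_generator (K : finFieldType) :
  exists theta : K, forall y, y != 0 -> exists k, y = theta ^+ k.
Proof.
have /cyclicP[g gE] := field_unit_group_cyclic [set: {unit K}]%G.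
exists (FinRing.uval g) => y ny; have yU : y \is a GRing.unit by rewrite unitfE.
have : FinRing.unit K yU \in <[g]>%g by rewrite -gE inE.
case/cycleP=> k yk; exists k.
by rewrite -FinRing.val_unitX -yk.
Qed.

Lemma iso_galois_ring_principal (R : finComNzRingType) (m : {set R})
    (p N n : nat) (K : finFieldType) (pi : {rmorphism R -> K}) :
  is_max_ideal m -> (forall J : {set R}, is_max_ideal J -> J = m) ->
  prime p -> (0 < N)%N -> (0 < n)%N ->
  (p ^ N)%:R = 0 :> R -> (p ^ N.-1)%:R != 0 :> R ->
  (forall y : K, exists x : R, pi x = y) ->
  (forall x : R, (pi x == 0) = (x \in m)) ->
  #|K| = (p ^ n)%N ->
  iso_galois_ring R p N n <->
    (forall x, x \in m -> exists y, x = p%:R * y).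
Proof.
move=> Hm Hloc p_pr N0 n0 R0 R0' pi_surj pi_ker cardK.
have [red redE] := reduction_rmorphism p_pr N0.
have map_redE (f : {poly 'Z_(p ^ N)}) :
    map_poly (fun c : 'Z_(p ^ N) => (val c)%:R : 'F_p) f = map_poly red f.
  by apply: eq_map_poly => c; rewrite redE.
split=> [[f [fm sf irrf [phi bphi]]] x xm|mpR].
  rewrite map_redE in irrf.
  apply: (galois_ring_principal p_pr _ _ _ fm sf irrf bphi xm).
  - exact: max_ideal_ideal.
  - exact: max_ideal1.
  - exact (natr_p_in_m p_pr pi_ker cardK).
have [theta thetaP] := finField_generator K.
have [a pia] := pi_surj theta.
have K0 : p%:R = 0 :> K by have /andP[_ /eqP] := card_finPcharP cardK p_pr.
have [j jE] := Fp_natr_rmorphism p_pr K0.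
have [iota iotaE] := Zp_natr_rmorphism p_pr N0 R0.
have pij c : pi (iota c) = j (red c).
  by rewrite iotaE redE !rmorph_nat.
have [f [fm sf irrf bij]] := galois_ring_iso p_pr N0 n0 cardK thetaP pi_ker
  (local_unit Hloc) mpR R0 R0' pia pij.
by exists f; split=> //; rewrite map_redE.
Qed.

Unset Implicit Arguments.

Theorem mainTheorem20
  (R : finComNzRingType) (m : {set R})
  (Hm : is_max_ideal m) (Hloc : forall J : {set R}, is_max_ideal J -> J = m)
  (p N n rho : nat) (Hp : prime p) (HN : (0 < N)%N)
  (Hchar : (p ^ N)%:R = 0 :> R) (Hchar' : (p ^ N.-1)%:R != 0 :> R)
  (K : finFieldType) (pi : {rmorphism R -> K})
  (Hpi_surj : forall y : K, exists x : R, pi x = y)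
  (Hpi_ker : forall x : R, (pi x == 0) = (x \in m))
  (Hn : (1 < n)%N) (HK : #|K| = (p ^ n)%N)
  (Hrho : #|m| = ((p ^ n) ^ rho * #|msq_pR m p|)%N) :
  let q := (p ^ n)%N in
  (* every maximal subring is of exactly one of the two kinds *)
  (forall S : {set R}, is_max_subring S ->
     ((pi @: S == setT) && ~~ is_max_subfield (pi @: S)) ||
     ((pi @: S != setT) && is_max_subfield (pi @: S)))
  (* kind (i): number of them *)
  /\ #|[set S : {set R} | is_max_subring S && (pi @: S == setT)]|
       = ((q ^ rho - 1) %/ (q - 1))%N
  (* kind (i): zero exactly for the Galois ring R(N,n) *)
  /\ (#|[set S : {set R} | is_max_subring S && (pi @: S == setT)]| = 0%N
       <-> iso_galois_ring R p N n)
  (* kind (i): each has index q *)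
  /\ (forall S : {set R}, is_max_subring S -> pi @: S = setT ->
        #|R| = (q * #|S|)%N)
  (* kind (ii): for each maximal subfield F, pi^-1(F) is the unique such maximal
     subring, and its index is [F_q : F] = #|K| / #|F| *)
  /\ (forall F : {set K}, is_max_subfield F ->
        [/\ is_max_subring (pi @^-1: F), pi @: (pi @^-1: F) = F,
            (forall S : {set R}, is_max_subring S -> pi @: S = F -> S = pi @^-1: F) &
            (#|R| * #|F| = #|K| * #|pi @^-1: F|)%N])
  (* number of kind-(ii) maximal subrings = number of prime divisors of n *)
  /\ #|[set S : {set R} | is_max_subring S && is_max_subfield (pi @: S)]|
       = size (primes n).
Proof.
move=> q.
have mI : is_ideal m := max_ideal_ideal Hm.
have JI : is_ideal (msq_pR m p) := msq_pR_ideal m p.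
have sJm := msq_pR_sub Hm Hp Hpi_ker HK.
have mmJ x y : x \in m -> y \in m -> x * y \in msq_pR m p := @msq_pR_mul R m p x y.
have pJ := msq_pR_p m p.
have q1 : (1 < q)%N by rewrite /q -HK finNzRing_gt1.
have [k [c [cD cZ c_surj c_ker]]] := cotangent_coordinates Hpi_surj Hpi_ker mI JI mmJ.
have J0 : (0 < #|msq_pR m p|)%N by apply/card_gt0P; exists 0; apply: mem_ideal0.
(* Both exponents satisfy the same equation for |m|; |J| is positive and cancels. *)
have ek : k = rho.
  have := card_by_coordinates mI sJm cD cZ c_surj c_ker.
  by rewrite Hrho HK => /eqP; rewrite eqn_pmul2r // eqn_exp2l // => /eqP.
subst k.
have max1P S : is_max_subring S -> pi @: S = setT ->
    exists2 u, u != 0 & S = der_ring c u.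
  move=> mS piS.
  apply: (max_subring_der_ring Hpi_surj Hpi_ker mI JI mmJ Hp HK pJ
    cD cZ c_surj c_ker mS piS).
  exact (max_subring_msq_pR Hm Hloc Hp Hpi_ker HK mS piS).
have count1 : #|[set S : {set R} | is_max_subring S && (pi @: S == setT)]|
    = ((q ^ rho - 1) %/ (q - 1))%N.
  rewrite /q -HK -(card_der_rings Hpi_ker mI JI mmJ cD cZ c_surj c_ker).
  apply: eq_card => S; rewrite inE; apply/andP/imsetP => [[mS /eqP piS]|[u]].
    by have [u nu ->] := max1P S mS piS; exists u; rewrite ?inE.
  rewrite inE => nu ->; split.
    exact: (der_ring_max Hpi_surj Hpi_ker mI JI mmJ Hp HK pJ cD cZ c_surj c_ker nu).
  by apply/eqP/(im_der_ring Hpi_surj Hpi_ker JI mmJ Hp HK pJ c_ker).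
split; [|split; [exact: count1|split; [|split; [|split]]]].
- move=> S mS; have [piS|npiS] := eqVneq (pi @: S) setT.
    by rewrite /is_max_subfield piS eqxx !andbF.
  by rewrite /= ?andbF; have [] := max_subring_im Hpi_surj mS npiS.
- rewrite count1.
  have -> : ((q ^ rho - 1) %/ (q - 1) = 0)%N <-> rho = 0%N.
    split=> [|->]; last by rewrite subnn div0n.
    case: rho {Hrho c cD cZ c_surj c_ker max1P count1} => // r.
    move/eqP; rewrite -leqn0 leqNgt divn_gt0 ?subn_gt0 // leq_sub2r //.
    by rewrite -{1}(expn1 q) leq_exp2l.
  rewrite (iso_galois_ring_principal Hm Hloc Hp HN (ltnW Hn) Hchar Hchar'
    Hpi_surj Hpi_ker HK).
  (* By cardinality, rho = 0 means that J is all of [m]; conversely m = pR puts [m] inside J. *)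
  split=> [r0 x xm|mpR].
    apply: (msq_pR_full_principal Hm Hloc _ _ xm).
      exact (natr_p_in_m Hp Hpi_ker HK).
    by apply/eqP; rewrite eqEcard sJm Hrho r0 expn0 mul1n leqnn.
  have sub : m \subset msq_pR m p.
    by apply/subsetP=> x /mpR[y ->]; apply: mem_idealMr.
  have := subset_leq_card sub; rewrite Hrho -[leqRHS]mul1n leq_pmul2r //.
  by rewrite -[1%N](expn0 q) leq_exp2l // leqn0 => /eqP.
- move=> S mS piS; have [u nu ->] := max1P S mS piS.
  rewrite /q -HK.
  exact (card_der_ring Hpi_ker mI JI mmJ Hp HK pJ cD cZ c_surj c_ker nu).
- move=> F mF; split.
  + exact: max_subfield_preim.
  + exact: im_preim_surj.
  + by move=> S mS; apply: max_subring_im_preim.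
  + have sF : is_subring F by move: mF; rewrite is_max_subfieldE; case/and3P.
    rewrite (@card_preim_additive _ _ pi F _ Hpi_surj); last first.
      by move=> x y; apply: subringB.
    rewrite -cardsT -(preimsetT pi) (@card_preim_additive _ _ pi _ _ Hpi_surj).
      by rewrite cardsT -mulnA [(#|F| * _)%N]mulnC.
    by move=> x y; rewrite !inE.
- rewrite card_max_subrings_im_subfield //; exact (card_max_subfields Hp HK Hn).
Qed.
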